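(* Let $F$ be a non-cyclic free group and let $\widehat F=\varprojlim_i F/\gamma_i(F)$ be its pronilpotent completion. Then the second integral homology group $H_2(\widehat F)=H_2(\widehat F,\mathbb Z)$ is not a cotorsion group.
   Context: For a group $G$, the lower central series is $\gamma_1(G)=G$, $\gamma_{i+1}(G)=[\gamma_i(G),G]$ for $i\ge 1$, and the pronilpotent completion of $G$ is $\widehat G=\varprojlim_i G/\gamma_i(G)$. Here $\widehat F$ is regarded as a discrete (abstract) group and $H_2$ is ordinary group homology. An abelian group $A$ is called cotorsion if $\mathrm{Ext}^1_{\mathbb Z}(\mathbb Q,A)=0$. *)

(* Defs.v *)
From HB Require Import structures.
From mathcomp Require Import all_boot all_order all_algebra.
From mathcomp Require Import boolp.
From mathcomp Require Import freeg.

Set Implicit Arguments.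
Unset Strict Implicit.
Unset Printing Implicit Defensive.

Import GRing.Theory.

Local Open Scope group_scope.

Definition free_on (X : Type) (F : groupType) (i : X -> F) : Prop :=
  forall (H : groupType) (f : X -> H),
    exists phi : {multiplicative F -> H},
      (forall x, phi (i x) = f x) /\
      (forall psi : {multiplicative F -> H},
          (forall x, psi (i x) = f x) -> psi =1 phi).

Definition is_free (F : groupType) : Prop :=
  exists (X : Type) (i : X -> F), free_on i.

Definition is_cyclic (G : groupType) : Prop :=
  exists x : G, forall y : G, exists n : nat, y = x ^+ n \/ y = x ^- n.

Section Generated.
Variables (G : groupType) (A : {pred G}).

Definition generated : {pred G} :=
  fun x => `[< forall H : groupClosed G, {subset A <= H} -> x \in H >].

Lemma generatedP x :
  reflect (forall H : groupClosed G, {subset A <= H} -> x \in H)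
          (x \in generated).
Proof. exact: asboolP. Qed.

Fact generated1 : 1 \in generated.
Proof. by apply/generatedP => H _; apply: gpred1. Qed.

Fact generatedM : mulg_closed generated.
Proof.
move=> x y /generatedP xA /generatedP yA.
by apply/generatedP => H AH; apply: gpredM; [apply: xA | apply: yA].
Qed.

Fact generatedV : invg_closed generated.
Proof.
move=> x /generatedP xA.
by apply/generatedP => H AH; rewrite gpredV; apply: xA.
Qed.

HB.instance Definition _ := isMulClosed.Build G generated generatedM.
HB.instance Definition _ := isMul1Closed.Build G generated generated1.
HB.instance Definition _ := isInvClosed.Build G generated generatedV.

Lemma sub_generated : {subset A <= generated}.
Proof. by move=> x xA; apply/generatedP => H; apply. Qed.

End Generated.

Definition commutators (G : groupType) (A B : {pred G}) : {pred G} :=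
  fun z => `[< exists x y, [/\ x \in A, y \in B & z = [~ x, y]] >].

Definition commutator_subgroup (G : groupType) (A B : {pred G}) : {pred G} :=
  generated (commutators A B).

HB.instance Definition _ (G : groupType) (A B : {pred G}) :=
  GroupClosed.on (@commutator_subgroup G A B).

(* Indexing is shifted by one: [lcs G n] is gamma_(n+1)(G). *)
Fixpoint lcs (G : groupType) (n : nat) : {pred G} :=
  if n is m.+1 then commutator_subgroup (@lcs G m) predT else predT.
Arguments lcs : clear implicits.

Section LowerCentralSeries.
Variable G : groupType.

Fact lcs1 n : 1 \in lcs G n.
Proof. by case: n => // n; apply: gpred1. Qed.

Fact lcsM n : mulg_closed (lcs G n).
Proof. by case: n => // n; apply: gpredM. Qed.

Fact lcsV n : invg_closed (lcs G n).
Proof. by case: n => // n; apply: gpredVr. Qed.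

HB.instance Definition _ n := isMulClosed.Build G (lcs G n) (@lcsM n).
HB.instance Definition _ n := isMul1Closed.Build G (lcs G n) (lcs1 n).
HB.instance Definition _ n := isInvClosed.Build G (lcs G n) (@lcsV n).

Lemma lcs_comm n x y : x \in lcs G n -> [~ x, y] \in lcs G n.+1.
Proof.
by move=> xG; apply: sub_generated; apply/asboolP; exists x, y; split.
Qed.

Lemma lcs_sub n : {subset lcs G n.+1 <= lcs G n}.
Proof.
elim: n => // n IHn x /generatedP; apply => _ /asboolP[y [z [yG _ ->]]].
by apply: lcs_comm; apply: IHn.
Qed.

Fact lcsJ n x y : x \in lcs G n -> x ^ y \in lcs G n.
Proof.
move=> xG; have -> : x ^ y = x * [~ x, y] by rewrite /commg mulVKg.
by apply: gpredM => //; apply/lcs_sub/lcs_comm.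
Qed.

End LowerCentralSeries.

HB.mixin Record isConjClosed (G : groupType) (S : {pred G}) := {
  gpredJr : forall x y, x \in S -> x ^ y \in S
}.

#[short(type="normalClosed")]
HB.structure Definition NormalClosed (G : groupType) :=
  {S of GroupClosed G S & isConjClosed G S}.

HB.instance Definition _ (G : groupType) n :=
  isConjClosed.Build G (lcs G n) (@lcsJ G n).

Section QuotientGroup.
Local Open Scope quotient_scope.
Variables (G : groupType) (N : normalClosed G).

Definition coset_equiv (x y : G) := x^-1 * y \in N.

Lemma coset_equiv_is_equiv : equiv_class_of coset_equiv.
Proof.
split=> [x|x y|y x z]; rewrite /coset_equiv.
- by rewrite mulVg gpred1.
- by rewrite -gpredV invgM invgK.
- by move=> xy yz; rewrite -[z](mulVKg y) mulgA gpredM.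
Qed.

Canonical coset_equiv_equiv := EquivRelPack coset_equiv_is_equiv.
Canonical coset_equiv_encModRel := defaultEncModRel coset_equiv.

Definition quotg := {eq_quot coset_equiv}.

HB.instance Definition _ : EqQuotient G coset_equiv quotg := EqQuotient.on quotg.
HB.instance Definition _ := Choice.on quotg.

Definition quotg_one : quotg := lift_cst quotg 1.
Definition quotg_mul := lift_op2 quotg (fun x y => x * y).
Definition quotg_inv := lift_op1 quotg (fun x => x^-1).

Lemma eq_quotg x y : (\pi_quotg x == \pi_quotg y) = (x^-1 * y \in N).
Proof. by rewrite eqmodE. Qed.

Lemma repr_quotg x : exists2 n, n \in N & repr (\pi_quotg x) = x * n.
Proof.
exists (x^-1 * repr (\pi_quotg x)); last by rewrite mulVKg.
by rewrite -eq_quotg reprK.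
Qed.

Canonical pi_quotg_one_morph := PiConst quotg_one.

Lemma pi_quotg_inv : {morph \pi_quotg : x / x^-1 >-> quotg_inv x}.
Proof.
move=> x; unlock quotg_inv; apply/eqP; rewrite eq_quotg invgK.
have [n nN ->] := repr_quotg x.
have -> : x * (x * n)^-1 = n^-1 ^ x^-1 by rewrite /conjg invgK invgM.
by apply: gpredJr; rewrite gpredV.
Qed.
Canonical pi_quotg_inv_morph := PiMorph1 pi_quotg_inv.

Lemma pi_quotg_mul : {morph \pi_quotg : x y / x * y >-> quotg_mul x y}.
Proof.
move=> x y; unlock quotg_mul; apply/eqP; rewrite eq_quotg.
have [n nN ->] := repr_quotg x; have [m mN ->] := repr_quotg y.
have -> : (x * y)^-1 * (x * n * (y * m)) = n ^ y * m.
  by rewrite /conjg invgM -!mulgA mulKg.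
by apply: gpredM => //; apply: gpredJr.
Qed.
Canonical pi_quotg_mul_morph := PiMorph2 pi_quotg_mul.

Fact quotg_mulA : associative quotg_mul.
Proof. by move=> x y z; rewrite -[x]reprK -[y]reprK -[z]reprK !piE mulgA. Qed.

Fact quotg_mul1 : left_id quotg_one quotg_mul.
Proof. by move=> x; rewrite -[x]reprK !piE mul1g. Qed.

Fact quotg_mul1r : right_id quotg_one quotg_mul.
Proof. by move=> x; rewrite -[x]reprK !piE mulg1. Qed.

Fact quotg_mulV : left_inverse quotg_one quotg_inv quotg_mul.
Proof. by move=> x; rewrite -[x]reprK !piE mulVg. Qed.

Fact quotg_mulVr : right_inverse quotg_one quotg_inv quotg_mul.
Proof. by move=> x; rewrite -[x]reprK !piE mulgV. Qed.

HB.instance Definition _ := isGroup.Build quotg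
  quotg_mulA quotg_mul1 quotg_mul1r quotg_mulV quotg_mulVr.

Fact pi_quotg_multiplicative : {morph \pi_quotg : x y / x * y}.
Proof. exact: pi_quotg_mul. Qed.

End QuotientGroup.

(* The canonical surjection G/N -> G/M, for N contained in M; it does not
   depend on the representative chosen by [repr] (see [quotg_mapE]). *)
Definition quotg_map (G : groupType) (N M : normalClosed G) (x : quotg N) :
    quotg M :=
  (\pi_(quotg M) (repr x))%qT.

Section QuotientMap.
Local Open Scope quotient_scope.
Variables (G : groupType) (N M : normalClosed G).
Hypothesis sNM : {subset N <= M}.

Lemma quotg_mapE (x : G) :
  quotg_map M (\pi_(quotg N) x) = \pi_(quotg M) x.
Proof.
have [n nN nE] := repr_quotg N x; apply/eqP; rewrite /quotg_map nE eq_quotg.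
by rewrite invgM mulgVK gpredV sNM.
Qed.

Lemma quotg_mapM : {morph @quotg_map G N M : x y / x * y}.
Proof.
move=> x y; rewrite -[x]reprK -[y]reprK -pi_quotg_multiplicative !quotg_mapE.
exact: pi_quotg_multiplicative.
Qed.

End QuotientMap.

Section InverseLimit.
Variables (G : nat -> groupType) (p : forall n, {multiplicative G n.+1 -> G n}).

Definition compatible : pred (forall n, G n) :=
  fun x => `[< forall n, p n (x n.+1) = x n >].

Record invlim := InvLim {
  thread :> forall n, G n;
  threadP : compatible thread
}.

HB.instance Definition _ := [isSub for thread].
HB.instance Definition _ := [Choice of invlim by <:].

Implicit Types x y z : invlim.

Lemma invlimE x n : p n (x n.+1) = x n.
Proof. by move/asboolP: (threadP x). Qed.

Lemma invlim_eq x y : (forall n, x n = y n) -> x = y.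
Proof. by move=> xy; apply/val_inj/functional_extensionality_dep. Qed.

Fact invlim1P : compatible (fun n => 1).
Proof.
by apply/asboolP => n; apply: (mulgI (p n 1)); rewrite -gmulfM !mulg1.
Qed.

Fact invlimMP x y : compatible (fun n => x n * y n).
Proof. by apply/asboolP => n; rewrite gmulfM !invlimE. Qed.

Fact invlimVP x : compatible (fun n => (x n)^-1).
Proof.
apply/asboolP => n; apply: (mulgI (x n)).
rewrite -{1}invlimE -gmulfM !mulgV.
by apply: (mulgI (p n 1)); rewrite -gmulfM !mulg1.
Qed.

Definition invlim1 := InvLim invlim1P.
Definition invlimM x y := InvLim (invlimMP x y).
Definition invlimV x := InvLim (invlimVP x).

Fact invlimA : associative invlimM.
Proof. by move=> x y z; apply: invlim_eq => n; apply: mulgA. Qed.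

Fact invlim1M : left_id invlim1 invlimM.
Proof. by move=> x; apply: invlim_eq => n; apply: mul1g. Qed.

Fact invlimM1 : right_id invlim1 invlimM.
Proof. by move=> x; apply: invlim_eq => n; apply: mulg1. Qed.

Fact invlimVM : left_inverse invlim1 invlimV invlimM.
Proof. by move=> x; apply: invlim_eq => n; apply: mulVg. Qed.

Fact invlimMV : right_inverse invlim1 invlimV invlimM.
Proof. by move=> x; apply: invlim_eq => n; apply: mulgV. Qed.

HB.instance Definition _ := isGroup.Build invlim
  invlimA invlim1M invlimM1 invlimVM invlimMV.

End InverseLimit.

Section PronilpotentCompletion.
Variable G : groupType.

Definition lcs_quot (n : nat) : groupType := quotg (lcs G n).

Definition lcs_proj (n : nat) : lcs_quot n.+1 -> lcs_quot n :=
  @quotg_map G (lcs G n.+1) (lcs G n).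

HB.instance Definition _ n :=
  isMultiplicative.Build (lcs_quot n.+1) (lcs_quot n) (@lcs_proj n)
    (quotg_mapM (@lcs_sub G n)).

Definition pronilpotent_completion : groupType := invlim lcs_proj.

End PronilpotentCompletion.

Local Close Scope group_scope.

Local Open Scope ring_scope.

Section Kernel.
Variables (U V : zmodType) (g : {additive U -> V}).

Definition in_ker : {pred U} := fun x => g x == 0.

Fact in_ker_zmod_closed : zmod_closed in_ker.
Proof.
split=> [|x y]; rewrite !unfold_in ?raddf0// => /eqP x0 /eqP y0.
by rewrite raddfB x0 y0 subrr.
Qed.

HB.instance Definition _ := GRing.isZmodClosed.Build U in_ker in_ker_zmod_closed.

Record kernel := Kernel { kernel_val : U; kernelP : kernel_val \in in_ker }.

HB.instance Definition _ := [isSub for kernel_val].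
HB.instance Definition _ := [Choice of kernel by <:].
HB.instance Definition _ := [SubChoice_isSubZmodule of kernel by <:].

Fact kernel_val_is_additive : zmod_morphism kernel_val.
Proof. by []. Qed.

HB.instance Definition _ :=
  GRing.isZmodMorphism.Build kernel U kernel_val kernel_val_is_additive.

End Kernel.

(* Ker g / Im f; no use is made of g \o f = 0, which holds in every case
   considered below. *)
Section Homology.
Variables (U V W : zmodType) (f : {additive U -> V}) (g : {additive V -> W}).

Definition boundaries : {pred kernel g} := fun z => `[< exists u, kernel_val z = f u >].

Fact boundaries_zmod_closed : zmod_closed boundaries.
Proof.
split=> [|x y]; first by apply/asboolP; exists 0; rewrite !raddf0.
move=> /asboolP[u xu] /asboolP[v yv]; apply/asboolP; exists (u - v).
by rewrite !raddfB /= xu yv.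
Qed.

HB.instance Definition _ :=
  GRing.isZmodClosed.Build (kernel g) boundaries boundaries_zmod_closed.

Definition homology : zmodType := {ideal_quot boundaries}.

End Homology.

(* The additive extension of f to the free abelian group on K *)
Section FreeLift.
Variables (K : choiceType) (V : zmodType) (f : K -> V).

Definition free_lift (D : {freeg K}) : V := fglift (f : K -> zmodule V) D.

Fact free_lift_is_additive : zmod_morphism free_lift.
Proof. exact: (lift_is_additive (f : K -> zmodule V)). Qed.

HB.instance Definition _ :=
  GRing.isZmodMorphism.Build {freeg K} V free_lift free_lift_is_additive.

Lemma free_liftU x : free_lift << x >> = f x.
Proof. by rewrite /free_lift liftU scale1r. Qed.

End FreeLift.

(* The inhomogeneous bar complex of G tensored with the trivial module Z:
   the n-chains are Z[G^n], and the faces of [g_0|...|g_n] are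
     [g_1|...|g_n],  [g_0|...|g_(i-1) g_i|...|g_n],  [g_0|...|g_(n-1)]
   for i = 0, 0 < i <= n and i = n+1 respectively. *)
Section GroupHomology.
Variable G : groupType.

Definition bar_chain (n : nat) : zmodType := {freeg {ffun 'I_n -> G}}.

Definition bar_face (n i : nat) (g : {ffun 'I_n.+1 -> G}) :
    {ffun 'I_n -> G} :=
  [ffun j : 'I_n =>
     let gj := g (widen_ord (leqnSn n) j) in
     let gj1 := g (fintype.lift ord0 j) in
     if (j.+1 < i)%N then gj
     else if j.+1 == i then (gj * gj1)%g
     else gj1].

Definition bar_boundary (n : nat) : {additive bar_chain n.+1 -> bar_chain n} :=
  free_lift (fun g : {ffun 'I_n.+1 -> G} =>
    \sum_(i < n.+2) << (-1) ^+ i *g bar_face i g >> : bar_chain n).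

(* The outgoing map is 0 in degree 0. *)
Definition group_homology (n : nat) : zmodType :=
  if n is m.+1 then homology (bar_boundary m.+1) (bar_boundary m)
  else homology (bar_boundary 0) (\0 : {additive bar_chain 0 -> bar_chain 0}).

End GroupHomology.

Section Hom.
Variables U V : zmodType.

Definition Hom : Type := {additive U -> V}.

HB.instance Definition _ := gen_eqMixin Hom.
HB.instance Definition _ := gen_choiceMixin Hom.

Implicit Types phi psi chi : Hom.

Definition Hom_fun phi : U -> V := phi.

Lemma Hom_eq phi psi : Hom_fun phi =1 Hom_fun psi -> phi = psi.
Proof.
case: phi psi => [f [[fP]]] [g [[gP]]]; rewrite /Hom_fun /= => fg.
have efg : f = g by apply: functional_extensionality_dep.
subst g.
by rewrite (Prop_irrelevance fP gP).
Qed.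

Definition Hom0 : Hom := (\0 : {additive U -> V}).
Definition HomD phi psi : Hom := (phi \+ psi : {additive U -> V}).
Definition HomN phi : Hom := (\- phi : {additive U -> V}).

Fact HomA : associative HomD.
Proof. by move=> *; apply: Hom_eq => x; apply: addrA. Qed.

Fact HomC : commutative HomD.
Proof. by move=> *; apply: Hom_eq => x; apply: addrC. Qed.

Fact Hom0D : left_id Hom0 HomD.
Proof. by move=> *; apply: Hom_eq => x; apply: add0r. Qed.

Fact HomND : left_inverse Hom0 HomN HomD.
Proof. by move=> *; apply: Hom_eq => x; apply: addNr. Qed.

HB.instance Definition _ := GRing.isZmodule.Build Hom HomA HomC Hom0D HomND.

End Hom.

Section Precomp.
Variables (U V A : zmodType) (d : {additive U -> V}).

Definition precomp (phi : Hom V A) : Hom U A :=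
  ((phi : {additive V -> A}) \o d : {additive U -> A}).

Fact precomp_is_additive : zmod_morphism precomp.
Proof. by move=> phi psi; apply: Hom_eq. Qed.

HB.instance Definition _ :=
  GRing.isZmodMorphism.Build (Hom V A) (Hom U A) precomp precomp_is_additive.

End Precomp.

(* The canonical free resolution of B: the term of degree 0 is Z[B], with
   augmentation Z[B] -> B, and the term of degree n+1 is Z[K], where K is the
   kernel of the map out of the term of degree n. *)
Section FreeResolution.
Variable B : zmodType.

Definition augmentation (V : zmodType) : {additive {freeg V} -> V} :=
  free_lift (id : V -> V).

Fixpoint syzygy (n : nat) : zmodType :=
  if n is m.+1 then kernel (augmentation (syzygy m)) else B.

Definition free_res (n : nat) : zmodType := {freeg (syzygy n)}.

Definition free_res_diff (n : nat) : {additive free_res n.+1 -> free_res n} :=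
  (@kernel_val _ _ (augmentation (syzygy n)) \o augmentation (syzygy n.+1)).

End FreeResolution.

Definition Ext (n : nat) (B A : zmodType) : zmodType :=
  if n is m.+1
  then homology (@precomp _ _ A (free_res_diff B m))
                (@precomp _ _ A (free_res_diff B m.+1))
  else kernel (@precomp _ _ A (free_res_diff B 0)).

Definition cotorsion (A : zmodType) : Prop := forall x : Ext 1 rat A, x = 0.

(* Main.v *)
(* Let a, b be two of the free generators and let M = k[[x]] for a prime field
   k = F_p. Sending a to 1 in M and b to the generator of Z, which acts on M as
   t = 1 + x, the group F^ maps to the semidirect product of Z and M. If phi and
   psi are additive maps from M to K = k(x) with phi(tm) = t phi(m) and
   psi(tm) = t^-1 psi(m), then phi(m) psi(n) is an invariant form on M; it
   extends to a 2-cocycle and so defines a homomorphism H_2(F^) -> K.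

   The commutator of two infinite products A_e, A_e' of iterated commutators
   [a, b, ..., b] equals [U, a][V, b] for some U, V in the derived subgroup.
   This relation is a class in H_2(F^), and when phi and psi vanish on the image
   of a its value is phi(e) psi(e') - phi(e') psi(e), where e, e' in M are the
   0/1 series of exponents. For lacunary series with independent supports,
   suitable phi_i, psi_j (i, j in N) take the value (n = i)(n = j) on a class
   c_n that does not depend on p.

   If H_2(F^) were cotorsion, there would be z_n with
   z_n = c_n + (n + 2) z_(n+1), so z_0 = sum_(n < p-1) (n+1)! c_n + p! z_(p-1),
   and the values of z_0 would form an invertible diagonal matrix of size p - 1
   over K. But z_0 is represented by a cycle with some number r of simplices,
   independent of p, which bounds the rank of this matrix by r. *)
Require Import Defs.
From HB Require Import structures.
From mathcomp Require Import all_boot all_order all_algebra.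
From mathcomp Require Import boolp classical_sets.
From mathcomp Require Import freeg ring zify.

Set Implicit Arguments.
Unset Strict Implicit.
Unset Printing Implicit Defensive.

Import GRing.Theory Num.Theory.
Local Open Scope ring_scope.

(** * Cotorsion groups *)

Lemma freegU_int (K : choiceType) (c : int) (x : K) :
  << c *g x >> = << x >> *~ c :> {freeg K}.
Proof. by rewrite freegU_mulz intz. Qed.

Lemma freeg_additive_ext (K : choiceType) (V : zmodType)
    (f g : {additive {freeg K} -> V}) :
  (forall x, f << x >> = g << x >>) -> f =1 g.
Proof.
move=> fg D; rewrite -(freeg_sumE D) !raddf_sum; apply: eq_bigr => x _.
by rewrite freegU_int !raddfMz fg.
Qed.

Lemma free_lift_sum (K : choiceType) (V : zmodType) (f : K -> V) D :
  free_lift f D = \sum_(x <- dom D) f x *~ coeff x D.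
Proof.
rewrite -[in LHS](freeg_sumE D) raddf_sum; apply: eq_bigr => x _.
by rewrite freegU_int raddfMz /= free_liftU.
Qed.

Lemma pi_homologyP (U V W : zmodType) (f : {additive U -> V})
    (g : {additive V -> W}) (z z' : kernel g) :
  (\pi_(homology f g) z = \pi_(homology f g) z')%qT <->
  exists u, kernel_val z - kernel_val z' = f u.
Proof.
rewrite /homology; split.
  move/eqP; rewrite eqquotE /= => /asboolP[u].
  by rewrite raddfB => zu; exists u.
case=> u zu; apply/eqP; rewrite eqquotE; apply/asboolP; exists u.
by rewrite raddfB.
Qed.

(** A map on the kernel of Z[Q] -> Q, pulled back along the augmentation, is a 1-cocycle; a cochain
    that bounds it is the required extension to Z[Q]. *)
Lemma cotorsion_extends (A : zmodType) (xi : {additive syzygy rat 1 -> A}) :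
  cotorsion A ->
  exists eta : {additive {freeg rat} -> A},
    forall k : syzygy rat 1, eta (kernel_val k) = xi k.
Proof.
move=> Acot.
pose f : Defs.Hom (free_res rat 1) A :=
  (xi \o augmentation (syzygy rat 1) : {additive free_res rat 1 -> A}).
have f_cocycle : f \in in_ker (@precomp _ _ A (free_res_diff rat 1)).
  rewrite unfold_in; apply/eqP/Hom_eq => x /=.
  rewrite /Hom_fun /= /f /=.
  have -> := eqP (kernelP (augmentation (syzygy rat 2) x)).
  by rewrite raddf0.
have := Acot (\pi_(Ext 1 rat A) (Kernel f_cocycle))%qT.
rewrite -[RHS](raddf0 (\pi_(Ext 1 rat A)))%qT => /pi_homologyP[u].
rewrite raddf0 addr0 /= => fu.
exists (u : {additive {freeg rat} -> A}) => k.
have := congr1 (fun h : Defs.Hom _ _ => Hom_fun h << k >>) fu.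
by rewrite /Hom_fun /= !free_liftU.
Qed.

(* Extended to Z[Q], these functions restrict on the kernel of Z[Q] -> Q to
   coordinates dual to the elements <<1/(n+1)!>> - (n+2) <<1/(n+2)!>>; only
   finitely many of them are nonzero at a given element of the kernel. *)
Definition fact_multiple (N : nat) (q : rat) : int :=
  let r := q * N.+1`!%:R in if r \is a Num.int then numq r else 0.

Lemma fact_multipleE N q (m : int) :
  q * N.+1`!%:R = m%:~R -> fact_multiple N q = m.
Proof. by rewrite /fact_multiple => ->; rewrite intr_int numq_int. Qed.

Lemma fact_dvdn_mono m n : (m <= n)%N -> (m`! %| n`!)%N.
Proof. by move=> mn; rewrite (fact_split mn) dvdn_mulr. Qed.

Lemma fact_multiple_inv N n :
  fact_multiple N (n.+1`!%:R^-1) =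
    if (n <= N)%N then (N.+1`! %/ n.+1`!)%N%:Z else 0.
Proof.
have n0 : n.+1`!%:R != 0 :> rat by rewrite pnatr_eq0 -lt0n fact_gt0.
case: leqP => nN.
  apply: fact_multipleE.
  rewrite -[in LHS](divnK (fact_dvdn_mono (_ : n < N.+1)%N)) //.
  by rewrite natrM mulrCA mulVf // mulr1.
rewrite /fact_multiple; case: ifP => // /intrP[m mE]; exfalso.
have /(congr1 ( *%R n.+1`!%:R)) := mE; rewrite mulVKf // => /eqP.
rewrite !pmulrn -intrM eqr_int => /eqP /(congr1 absz).
rewrite abszM !absz_nat => NE.
have : (n.+1`! <= N.+1`!)%N by rewrite dvdn_leq ?fact_gt0 // NE dvdn_mulr.
by rewrite leqNgt ltn_fact.
Qed.

Definition fact_multiple_lift N : {additive {freeg rat} -> int} :=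
  free_lift (fact_multiple N).

Lemma fact_multiple_lift_inv N n :
  fact_multiple_lift N (<< n.+1`!%:R^-1 >> - << n.+2`!%:R^-1 >> *+ n.+2)
    = (N == n)%:Z.
Proof.
rewrite raddfB raddfMn /= !free_liftU !fact_multiple_inv.
case: (ltngtP N n) => [Nn|nN|->].
- by rewrite mul0rn subrr.
- have /dvdnP[k ->] := fact_dvdn_mono (nN : n.+2 <= N.+1)%N.
  rewrite mulnK ?fact_gt0 // factS mulnA mulnK ?fact_gt0 //.
  by rewrite -mulr_natr natz -PoszM subrr.
- by rewrite divnn fact_gt0 mul0rn subr0.
Qed.

(** Once (N+1)! clears all denominators in the support of [D], the default 0 of [fact_multiple] no
    longer occurs. *)
Lemma fact_multiple_lift_aug (D : {freeg rat}) :
  exists B : nat, forall N : nat, (B <= N)%N ->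
    (fact_multiple_lift N D)%:~R = augmentation rat D * N.+1`!%:R.
Proof.
exists (\max_(q <- dom D) `|denq q|)%N => N BN.
rewrite /fact_multiple_lift /= !free_lift_sum mulr_suml.
rewrite (rmorph_sum (intr : {rmorphism int -> rat})) /= big_seq [RHS]big_seq.
apply: eq_bigr => q qD.
have qN : (0 < `|denq q| <= N.+1)%N.
  rewrite absz_gt0 denq_neq0 (leq_trans _ (leqW BN)) //.
  by rewrite (big_rem q qD) leq_maxl.
have /dvdnP[m mE] := dvdn_fact qN.
have qE : q * N.+1`!%:R = (numq q * m%:Z)%:~R.
  rewrite mE natrM mulrCA -[`|denq q|%:R]/(`|denq q|%:Z%:~R).
  by rewrite absz_denq -numqE mulrC intrM.
by rewrite (fact_multipleE qE) (raddfMz intr) /= -qE mulrzAl.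
Qed.

(** Some map on the kernel of Z[Q] -> Q sends <<1/(n+1)!>> - (n+2) <<1/(n+2)!>> to [a n]; extend it
    to Z[Q] and let [x n] be the value at 1/(n+1)!. *)
Lemma cotorsion_system (A : zmodType) (a : nat -> A) :
  cotorsion A -> exists x : nat -> A, forall n, x n = a n + x n.+1 *+ n.+2.
Proof.
pose l k N := fact_multiple_lift N (kernel_val (k : syzygy rat 1)).
have l_eventually0 (k : syzygy rat 1) :
    {B : nat | forall N, (B <= N)%N -> l k N = 0}.
  apply: cid; have [B BP] := fact_multiple_lift_aug (kernel_val k).
  exists B => N /BP/eqP; rewrite (eqP (kernelP k)) mul0r intr_eq0.
  exact: eqP.
pose B k := sval (l_eventually0 k).
(* The cutoff [B k] varies with [k]; by [xiE] any larger one gives the same sum, so additivity can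
   be checked at a common cutoff. *)
pose xi k := \sum_(i < B k) a i *~ l k i.
have xiE k C : (B k <= C)%N -> xi k = \sum_(i < C) a i *~ l k i.
  move=> kC; rewrite /xi -!(big_mkord predT (fun i => a i *~ l k i)).
  rewrite [RHS](big_cat_nat _ kC) //= [X in _ + X]big_nat_cond.
  rewrite [X in _ + X]big1 ?addr0 // => i /andP[/andP[Bi _] _].
  by rewrite (svalP (l_eventually0 k)).
have xiB : zmod_morphism xi.
  move=> k k'; pose C := maxn (B (k - k')) (maxn (B k) (B k')).
  rewrite !(@xiE _ C) ?leq_max ?leqnn ?orbT // -sumrB.
  apply: eq_bigr => i _; rewrite -mulrzBr; congr (_ *~ _).
  by rewrite /l !raddfB.
pose xiA := HB.pack_for {additive syzygy rat 1 -> A} xi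
  (GRing.isZmodMorphism.Build _ _ xi xiB).
move=> /(cotorsion_extends xiA)[eta etaE].
exists (fun n => eta << n.+1`!%:R^-1 >>) => n.
pose D : {freeg rat} := << n.+1`!%:R^-1 >> - << n.+2`!%:R^-1 >> *+ n.+2.
have kD : D \in in_ker (augmentation rat).
  rewrite unfold_in raddfB raddfMn /= !free_liftU (factS n.+1) natrM invfM.
  by rewrite -mulrnAl -[_^-1 *+ _]mulr_natr mulVf ?mul1r ?subrr ?pnatr_eq0.
have := etaE (Kernel kD); rewrite /= raddfB raddfMn => /eqP.
rewrite -[_ (Kernel kD)]/(xi _) subr_eq => /eqP ->; congr (_ + _).
rewrite (@xiE _ (maxn (B (Kernel kD)) n.+1)) ?leq_maxl //.
have nlt : (n < maxn (B (Kernel kD)) n.+1)%N by rewrite leq_max leqnn orbT.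
rewrite (bigD1 (Ordinal nlt)) //= big1 => [|i /negPf ni].
  by rewrite /l fact_multiple_lift_inv eqxx addr0.
by rewrite /l fact_multiple_lift_inv -[(i : nat) == n]/(i == Ordinal nlt) ni.
Qed.

(** * Pairing second homology with 2-cocycles *)

Section BarPairing.
Variables (G : groupType) (V : zmodType).

Definition bar1 (x : G) : bar_chain G 1 := << [ffun => x] >>.

Definition bar2 (x y : G) : bar_chain G 2 :=
  << [ffun i : 'I_2 => if i == ord0 then x else y] >>.

Lemma bar_boundary2 x y :
  bar_boundary G 1 (bar2 x y) = bar1 y - bar1 (x * y)%g + bar1 x.
Proof.
rewrite /bar_boundary /= free_liftU !big_ord_recl big_ord0 /= addr0.
have eqU (k k' : int) (f f' : {ffun 'I_1 -> G}) :
    k = k' -> f ord0 = f' ord0 -> << k *g f >> = << k' *g f' >> :> bar_chain G 1.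
  move=> -> ff'; suff -> : f = f' by [].
  by apply/ffunP => i; rewrite (ord1 i).
rewrite addrA addrAC -addrA [RHS]addrAC -addrA /bar1.
rewrite [- << _ >>]freegUN.
apply: f_equal2; last apply: f_equal2; apply: eqU; by rewrite // !ffunE //=.
Qed.

Definition cocycle2 (c : G -> G -> V) :=
  forall x y z, c y z - c (x * y)%g z + c x (y * z)%g - c x y = 0.

Definition eval2 (c : G -> G -> V) : {additive bar_chain G 2 -> V} :=
  free_lift (fun g : {ffun 'I_2 -> G} => c (g ord0) (g ord_max)).

Lemma eval2U c k (g : {ffun 'I_2 -> G}) :
  eval2 c << k *g g >> = c (g ord0) (g ord_max) *~ k.
Proof. by rewrite freegU_int raddfMz /= free_liftU. Qed.

Lemma eval2_bar2 c x y : eval2 c (bar2 x y) = c x y.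
Proof. by rewrite /eval2 /= free_liftU !ffunE. Qed.

Lemma eval2_boundary c : cocycle2 c -> forall u, eval2 c (bar_boundary G 2 u) = 0.
Proof.
move=> cc u.
pose z : {additive bar_chain G 3 -> V} := \0.
apply: (@freeg_additive_ext _ _ (eval2 c \o bar_boundary G 2) z) => g /=.
rewrite /bar_boundary free_liftU !big_ord_recl big_ord0 addr0 !raddfD.
rewrite !eval2U !ffunE /=.
have -> : widen_ord (leqnSn 2) ord_max = fintype.lift ord0 ord0 by apply/val_inj.
have := cc (g (widen_ord (leqnSn 2) ord0)) (g (fintype.lift ord0 ord0))
  (g (fintype.lift ord0 ord_max)).
have -> : (-1) ^+ bump 0 0 = -1 :> int by [].
have -> : (-1) ^+ bump 0 (bump 0 0) = 1 :> int by [].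
have -> : (-1) ^+ bump 0 (bump 0 (bump 0 0)) = -1 :> int by [].
by rewrite expr0 !mulr1z !mulrN1z !addrA.
Qed.

(** Read off the representative chosen by [repr]; for a cocycle [c] every other cycle in the class
    gives the same value. *)
Definition pairing (c : G -> G -> V) (x : group_homology G 2) : V :=
  eval2 c (kernel_val (repr (x : homology _ _))).

Lemma pairing_pi c (cc : cocycle2 c) z :
  pairing c (\pi_(homology (bar_boundary G 2) (bar_boundary G 1)) z)%qT
    = eval2 c (kernel_val z).
Proof.
rewrite /pairing; case: piP => z' /esym/pi_homologyP[u] zu.
by apply/eqP; rewrite -subr_eq0 -raddfB zu eval2_boundary.
Qed.

Lemma pairing_is_additive c (cc : cocycle2 c) : zmod_morphism (pairing c).
Proof.
move=> x y; rewrite -[x](@reprK _ (homology _ _)) -[y](@reprK _ (homology _ _)).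
by rewrite -raddfB !pairing_pi // raddfB.
Qed.

End BarPairing.

(** As uv = (vu)[u, v], the chain [k u v] has boundary -<[u, v]>; one more simplex multiplies the
    two commutators on the right. The class is chosen before [V] and [c], so that it serves all
    characteristics at once. *)
Lemma comm_relation_class (G : groupType) (x y x1 y1 x2 y2 : G) :
  [~ x, y]%g = ([~ x1, y1] * [~ x2, y2])%g ->
  exists h : group_homology G 2, forall (V : zmodType) (c : G -> G -> V),
    cocycle2 c ->
    let k x y := c x y - c y x - c (y * x)%g [~ x, y]%g in
    pairing c h = k x y - k x1 y1 - k x2 y2 - c [~ x1, y1]%g [~ x2, y2]%g.
Proof.
move=> xyE.
pose k (x y : G) := bar2 x y - bar2 y x - bar2 (y * x)%g [~ x, y]%g.
have dk (u v : G) : bar_boundary G 1 (k u v) = - bar1 [~ u, v]%g.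
  rewrite /k !raddfB /= !bar_boundary2 -commgC.
  apply/eqP; rewrite subr_eq !addrA addNr sub0r subr_eq [bar1 u - _]addrC !addrA.
  by rewrite addrK [bar1 v - _]addrC addrAC.
pose z := k x y - k x1 y1 - k x2 y2 - bar2 [~ x1, y1]%g [~ x2, y2]%g.
have zk : z \in in_ker (bar_boundary G 1).
  rewrite unfold_in /z 3!raddfB bar_boundary2 !dk xyE.
  by rewrite !opprK [- _ + bar1 _ + _]addrAC [- _ + bar1 _]addrC subrr.
exists (\pi_(homology (bar_boundary G 2) (bar_boundary G 1)) (Kernel zk))%qT.
move=> V c cc k'; rewrite pairing_pi //= /z /k.
by rewrite !raddfB /= !eval2_bar2.
Qed.

(* [s] and [m] depend on [x] only: the size of [s] bounds the rank of every
   matrix of pairings with [x]. *)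
Lemma pairing_sum (G : groupType) (x : group_homology G 2) :
  exists (s : seq (G * G)) (m : G * G -> int),
    forall (V : zmodType) (c : G -> G -> V),
      pairing c x = \sum_(g <- s) c g.1 g.2 *~ m g.
Proof.
pose z : bar_chain G 2 := kernel_val (repr (x : homology _ _)).
pose h (g : G * G) := [ffun i : 'I_2 => if i == ord0 then g.1 else g.2].
exists [seq (g ord0, g ord_max) | g : {ffun 'I_2 -> G} <- dom z].
exists (fun g => coeff (h g) z) => V c.
rewrite /pairing /eval2 /= free_lift_sum big_map; apply: eq_bigr => g _.
congr (_ *~ coeff _ _); apply/ffunP => i; rewrite ffunE /=.
by case: eqP => [->|/eqP i0] //; congr (g _); apply/val_inj; case: i i0 => [[|[]]].
Qed.

(** * Groups *)

Lemma generated_ind (G : groupType) (A S : {pred G}) :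
  1%g \in S -> mulg_closed S -> invg_closed S -> {subset A <= S} ->
  {subset generated A <= S}.
Proof.
move=> S1 SM SV AS x.
pose SG := HB.pack_for (groupClosed G) S (isMulClosed.Build G S SM)
  (isMul1Closed.Build G S S1) (isInvClosed.Build G S SV).
by move=> /generatedP/(_ SG); apply.
Qed.

(* [gmulf1] and its consequences are stated for unital morphisms only. *)
Section Multiplicative.
Local Open Scope group_scope.
Variables (G H : groupType) (f : {multiplicative G -> H}).

Lemma multiplicative1 : f 1 = 1.
Proof. by apply: (mulgI (f 1)); rewrite -gmulfM !mulg1. Qed.

Lemma multiplicativeV : {morph f : x / x^-1}.
Proof.
by move=> x; apply: (mulgI (f x)); rewrite -gmulfM !mulgV multiplicative1.
Qed.

Lemma multiplicativeR : {morph f : x y / [~ x, y]}.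
Proof. by move=> x y; rewrite /commg /conjg !gmulfM !multiplicativeV. Qed.

End Multiplicative.

Section GeneratedGroup.
Local Open Scope group_scope.
Variables (G : groupType) (A : {pred G}).

Definition generated_group : Type := {x | x \in generated A}.

HB.instance Definition _ := SubType.copy generated_group {x | x \in generated A}.
HB.instance Definition _ := [Choice of generated_group by <:].

Fact generated_group_closed : group_closed (generated A).
Proof. by split; [apply: gpred1 | move=> x y; apply: gpredF]. Qed.

HB.instance Definition _ :=
  SubChoice_isSubGroup.Build G (generated A) generated_group generated_group_closed.

Lemma generated_group_gen (g : generated_group) :
  g \in generated [pred y : generated_group | val y \in A].
Proof.
pose S := generated [pred y : generated_group | val y \in A].
pose T : {pred G} :=
  fun z => `[< exists2 x : generated_group, x \in S & val x = z >].
have T1 : 1 \in T by apply/asboolP; exists 1; rewrite ?gpred1 ?val1.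
have TM : mulg_closed T.
  move=> _ _ /asboolP[x xS <-] /asboolP[y yS <-]; apply/asboolP; exists (x * y).
    exact: gpredM.
  exact: valM.
have TV : invg_closed T.
  move=> _ /asboolP[x xS <-]; apply/asboolP; exists x^-1; first by rewrite gpredV.
  exact: (multiplicativeV (val : {multiplicative generated_group -> G})).
have /asboolP[y yS /val_inj <-//] : val g \in T.
apply: (generated_ind T1 TM TV) (valP g) => z zA; apply/asboolP.
exists (Sub z (sub_generated zA)); last exact: SubK.
by apply: sub_generated; rewrite inE SubK.
Qed.

End GeneratedGroup.

Lemma int_step_ind (P : int -> Prop) :
  P 0 -> (forall i, P i -> P (i + 1)) -> (forall i, P i -> P (i - 1)) ->
  forall i, P i.
Proof.
move=> P0 PS PP; elim/int_ind => [//|n /PS|n /PP].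
  by rewrite -PoszD addn1.
by rewrite -opprD -PoszD addn1.
Qed.

Section Powers.
Local Open Scope group_scope.
Variables (G : groupType) (g : G).

Definition zexp (i : int) : G :=
  match i with Posz n => g ^+ n | Negz n => g ^- n.+1 end.

Lemma zexpS i : zexp (i + 1)%R = zexp i * g.
Proof.
case: i => [n|[|n]]; first by rewrite -PoszD addn1 /= expgSr.
  by rewrite /= mulVg.
have -> : (Negz n.+1 + 1)%R = Negz n by rewrite !NegzE -addn1 PoszD opprD addrNK.
by rewrite /= [in RHS]expgS invgM mulgVK.
Qed.

Lemma zexpD i j : zexp (i + j)%R = zexp i * zexp j.
Proof.
elim/int_step_ind: j => [|j IHj|j IHj]; first by rewrite addr0 mulg1.
  by rewrite addrA !zexpS IHj mulgA.
by apply: (mulIg g); rewrite -mulgA -!zexpS -!addrA !addNr !addr0.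
Qed.

End Powers.

(** * The semidirect product of Z and k[[x]] *)

Section PowerSeries.
Variable k : fieldType.

Definition pser : Type := nat -> k.

HB.instance Definition _ := gen_eqMixin pser.
HB.instance Definition _ := gen_choiceMixin pser.

Implicit Types m : pser.

Definition pser0 : pser := fun=> 0.
Definition pserD m (n : pser) : pser := fun i => m i + n i.
Definition pserN m : pser := fun i => - m i.

Fact pserA : associative pserD.
Proof. by move=> *; apply/funext => i; apply: addrA. Qed.

Fact pserC : commutative pserD.
Proof. by move=> *; apply/funext => i; apply: addrC. Qed.

Fact pser0D : left_id pser0 pserD.
Proof. by move=> *; apply/funext => i; apply: add0r. Qed.

Fact pserND : left_inverse pser0 pserN pserD.
Proof. by move=> *; apply/funext => i; apply: addNr. Qed.

HB.instance Definition _ := GRing.isZmodule.Build pser pserA pserC pser0D pserND.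

Lemma pserDE m (n : pser) i : (m + n) i = m i + n i. Proof. by []. Qed.
Lemma pserNE m i : (- m) i = - m i. Proof. by []. Qed.

Definition pserZ (P : {poly k}) m : pser :=
  fun n => \sum_(i < n.+1) P`_i * m (n - i)%N.

(** Low coefficients see only a truncation of [m], which reduces associativity and the unit law of
    the action to polynomials. *)
Lemma pserZ_poly N P m n :
  (n <= N)%N -> pserZ P m n = (P * \poly_(i < N.+1) m i)`_n.
Proof.
move=> nN; rewrite coefM; apply: eq_bigr => i _; rewrite coef_poly.
by rewrite ltnS (leq_trans (leq_subr _ _) nN).
Qed.

Fact pserZA P Q m : pserZ P (pserZ Q m) = pserZ (P * Q) m.
Proof.
apply/funext => n; rewrite (pserZ_poly (P * Q) m (leqnn n)) -mulrA coefM.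
by apply: eq_bigr => i _; rewrite (pserZ_poly Q m (leq_subr i n)).
Qed.

Fact pserZ1 : left_id 1 pserZ.
Proof.
move=> m; apply/funext => n; rewrite (pserZ_poly _ _ (leqnn n)) mul1r.
by rewrite coef_poly ltnSn.
Qed.

Fact pserZDr : right_distributive pserZ +%R.
Proof.
move=> P m n; apply/funext => i; rewrite pserDE -big_split /=.
by apply: eq_bigr => j _; rewrite pserDE mulrDr.
Qed.

Fact pserZDl m : {morph pserZ^~ m : P Q / P + Q}.
Proof.
move=> P Q; apply/funext => i; rewrite pserDE -big_split /=.
by apply: eq_bigr => j _; rewrite coefD mulrDl.
Qed.

HB.instance Definition _ := GRing.Zmodule_isLmodule.Build {poly k} pser
  pserZA pserZ1 pserZDr pserZDl.

(* Conjugation by the generator of the acting cyclic group is t = 1 + x. *)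
Definition unip m : pser := fun i => m i + (if i is j.+1 then m j else 0).

(** The coefficients of m / (1 + x), found recursively. *)
Fixpoint unipV_coef m (i : nat) : k :=
  if i is j.+1 then m i - unipV_coef m j else m 0%N.

Definition unipV m : pser := unipV_coef m.

Lemma unipVK : cancel unipV unip.
Proof.
move=> m; apply/funext => -[|i]; rewrite /unip /unipV /= ?addr0 //.
by rewrite subrK.
Qed.

Lemma unipK : cancel unip unipV.
Proof.
move=> m; apply/funext; rewrite /unipV; elim=> [|i IHi] /=; first exact: addr0.
by rewrite IHi /unip addrK.
Qed.

Lemma unipB : {morph unip : m n / m - n}.
Proof.
move=> m n; apply/funext => -[|i]; rewrite /unip /= !pserDE !pserNE ?addr0 //.
by rewrite opprD addrACA.
Qed.

Lemma unipE m : unip m = (1 + 'X) *: m.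
Proof.
apply/funext => i; rewrite scalerDl scale1r pserDE; congr (_ + _).
rewrite -[RHS]/(pserZ _ _ _) /pserZ; case: i => [|i].
  by rewrite big_ord1 coefX mul0r.
rewrite big_ord_recl coefX mul0r add0r big_ord_recl coefX mul1r big1 ?addr0.
  by rewrite subSS subn0.
by move=> j _; rewrite coefX mul0r.
Qed.

Definition zact (i : int) m : pser :=
  match i with Posz n => iter n unip m | Negz n => iter n.+1 unipV m end.

Lemma zactS i m : zact (i + 1) m = unip (zact i m).
Proof.
case: i => [n|[|n]]; first by rewrite -PoszD addn1.
  by rewrite /= unipVK.
have -> : Negz n.+1 + 1 = Negz n by rewrite !NegzE -addn1 PoszD opprD addrNK.
by rewrite [in RHS]/zact iterS unipVK.
Qed.

Lemma zactP i m : zact (i - 1) m = unipV (zact i m).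
Proof. by rewrite -{2}[i](subrK 1) zactS unipK. Qed.

Lemma zactD i j m : zact (i + j) m = zact i (zact j m).
Proof.
elim/int_step_ind: i => [|i IHi|i IHi]; first by rewrite add0r.
  by rewrite addrAC !zactS IHi.
by rewrite addrAC !zactP IHi.
Qed.

Lemma zactB i : {morph zact i : m n / m - n}.
Proof.
move=> m n; elim/int_step_ind: i => [//|i IHi|i IHi].
  by rewrite !zactS IHi unipB.
by apply: (can_inj unipK); rewrite !zactP unipB !unipVK.
Qed.

HB.instance Definition _ i :=
  GRing.isZmodMorphism.Build pser pser (zact i) (zactB i).

(** Membership in x^d k[[x]]. *)
Definition low_zero (d : nat) m := forall i, (i < d)%N -> m i = 0.

Lemma low_zero_unip d m : low_zero d m -> low_zero d (unip m).
Proof.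
move=> m0 [|i] id; rewrite /unip m0 // ?add0r ?addr0 //.
by rewrite m0 // ltnW.
Qed.

Lemma low_zero_unipV d m : low_zero d m -> low_zero d (unipV m).
Proof.
move=> m0; elim=> [|i IHi] id; rewrite /unipV /= m0 //.
by rewrite -/(unipV m i) IHi ?subrr // ltnW.
Qed.

Lemma low_zero_zact d i m : low_zero d m -> low_zero d (zact i m).
Proof.
move=> m0; elim/int_step_ind: i => [//|i IHi|i IHi].
  by rewrite zactS; apply: low_zero_unip.
by rewrite zactP; apply: low_zero_unipV.
Qed.

(** For t = 1 + x, t^i - 1 is divisible by x, also when i is negative. *)
Lemma low_zero_zactB d i m : low_zero d m -> low_zero d.+1 (zact i m - m).
Proof.
move=> m0.
have unip_sub (n : pser) : low_zero d n -> low_zero d.+1 (unip n - n).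
  move=> n0 [|j] jd; rewrite pserDE pserNE /unip; first by rewrite addr0 subrr.
  by rewrite addrAC subrr add0r n0.
elim/int_step_ind: i => [j _|i IHi|i IHi] /=; first by rewrite pserDE pserNE subrr.
  rewrite zactS => j jd; have -> : unip (zact i m) - m =
      (unip (zact i m) - zact i m) + (zact i m - m) by rewrite addrA subrK.
  by rewrite pserDE IHi // unip_sub ?addr0 //; apply: low_zero_zact.
rewrite zactP => j jd; have -> : unipV (zact i m) - m =
    (zact i m - m) - (unip (unipV (zact i m)) - unipV (zact i m)).
  by rewrite unipVK opprB [RHS]addrC addrA subrK.
rewrite pserDE pserNE IHi // unip_sub ?subrr //.
by apply/low_zero_unipV/low_zero_zact.
Qed.

End PowerSeries.

Section Lamplighter.
Variable k : fieldType.

(* The semidirect product of Z and k[[x]]; [(i, m)] stands for b^i m, where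
   conjugation by b is multiplication by 1 + x. *)
Definition lamp : Type := (int * pser k)%type.

HB.instance Definition _ := Choice.on lamp.

Implicit Types g h : lamp.

Definition lamp1 : lamp := (0, 0).
Definition lampM g h : lamp := (g.1 + h.1, zact h.1 g.2 + h.2).
Definition lampV g : lamp := (- g.1, - zact (- g.1) g.2).

Fact lampA : associative lampM.
Proof.
move=> g h l; rewrite /lampM /= addrA; congr pair.
by rewrite raddfD /= -zactD [l.1 + h.1]addrC addrA.
Qed.

Fact lamp1M : left_id lamp1 lampM.
Proof. by case=> i m; rewrite /lampM /= add0r raddf0 add0r. Qed.

Fact lampM1 : right_id lamp1 lampM.
Proof. by case=> i m; rewrite /lampM /= !addr0. Qed.

Fact lampVM : left_inverse lamp1 lampV lampM.
Proof.
case=> i m; rewrite /lampM /= addNr raddfN /= -zactD subrr /=.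
by rewrite addNr.
Qed.

Fact lampMV : right_inverse lamp1 lampV lampM.
Proof. by case=> i m; rewrite /lampM /= !subrr. Qed.

HB.instance Definition _ := isGroup.Build lamp
  lampA lamp1M lampM1 lampVM lampMV.

Lemma lampME g h : (g * h)%g = (g.1 + h.1, zact h.1 g.2 + h.2) :> lamp.
Proof. by []. Qed.

Lemma lampM1E g h : (g * h)%g.1 = g.1 + h.1. Proof. by []. Qed.

Lemma lampM2E g h i : (g * h)%g.2 i = zact h.1 g.2 i + h.2 i.
Proof. by []. Qed.

Lemma lampVE g : g^-1%g = (- g.1, - zact (- g.1) g.2) :> lamp.
Proof. by []. Qed.

Lemma lampRE g h :
  [~ g, h]%g = (0, (zact h.1 g.2 - g.2) - (zact g.1 h.2 - h.2)) :> lamp.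
Proof.
have -> : [~ g, h]%g = ((h * g)^-1 * (g * h))%g.
  by rewrite /commg /conjg invgM !mulgA.
rewrite !lampME lampVE /= [h.1 + g.1]addrC addNr; congr pair.
rewrite raddfN /= -zactD subrr /= [LHS]addrC opprB addrACA.
by rewrite opprD [- _ - _]addrC.
Qed.

(** For d > 0 this is the subgroup x^d k[[x]]; for d = 0 it is the whole group. *)
Definition deep (d : nat) g := ((0 < d)%N -> g.1 = 0) /\ low_zero d g.2.

(** The commutator of (i, m) and (j, n) is (t^j - 1) m - (t^i - 1) n. The first term gains a factor
    x; the second is divisible by x when d = 0, and vanishes when d > 0 because then i = 0. *)
Lemma lcs_deep d g : g \in lcs lamp d -> deep d g.
Proof.
elim: d g => [|d IHd] g; first by [].
pose S : {pred lamp} := fun g => `[< deep d.+1 g >].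
have S1 : 1%g \in S by apply/asboolP; split.
have SM : mulg_closed S.
  move=> x y /asboolP[/(_ isT) x1 x2] /asboolP[/(_ isT) y1 y2].
  apply/asboolP; split=> [_|i id]; rewrite lampME /= ?x1 ?y1 ?addr0 //=.
  by rewrite pserDE x2 // y2 // addr0.
have SV : invg_closed S.
  move=> x /asboolP[/(_ isT) x1 x2]; apply/asboolP; split=> [_|i id].
    by rewrite lampVE /= x1 oppr0.
  by rewrite lampVE /= pserNE x1 oppr0 /= x2 // oppr0.
move=> /(generated_ind S1 SM SV) gS.
apply/asboolP/gS => z /asboolP[x [y [xd _ ->]]].
have [x1 x2] := IHd _ xd; apply/asboolP; rewrite lampRE; split=> //= i id.
rewrite pserDE pserNE (low_zero_zactB y.1 x2) // sub0r.
case: d => [|d] in x1 id x2 {IHd S S1 SM SV gS xd} *.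
  by rewrite (@low_zero_zactB _ 0) ?oppr0.
by rewrite x1 //= subrr oppr0.
Qed.

Variables (K : fieldType) (phi psi : pser k -> K) (T : K).
Hypotheses (phiD : {morph phi : x y / x + y}) (psiD : {morph psi : x y / x + y}).
Hypotheses (T0 : T != 0).
Hypotheses (phi_unip : forall m, phi (unip m) = T * phi m).
Hypotheses (psi_unip : forall m, psi (unip m) = T^-1 * psi m).

(** The cup square of the crossed homomorphism [g.2] under the form phi(m) psi(n). *)
Definition lamp_cocycle g h : K := phi (zact h.1 g.2) * psi h.2.

Lemma zact_form i m n : phi (zact i m) * psi (zact i n) = phi m * psi n.
Proof.
have unip_form m' n' : phi (unip m') * psi (unip n') = phi m' * psi n'.
  by rewrite phi_unip psi_unip mulrACA mulfV // mul1r.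
elim/int_step_ind: i => [//|i IHi|i <-].
  by rewrite !zactS unip_form.
by rewrite !zactP -unip_form !unipVK.
Qed.

(** After expansion two terms are left, and they cancel by the invariance [zact_form]. *)
Lemma lamp_cocycleP : cocycle2 lamp_cocycle.
Proof.
move=> g h l; rewrite /lamp_cocycle !lampME /= [h.1 + l.1]addrC zactD raddfD /=.
rewrite phiD psiD mulrDl mulrDr zact_form.
ring.
Qed.

End Lamplighter.

(** * The pronilpotent completion *)

Local Close Scope ring_scope.
Local Open Scope group_scope.

HB.instance Definition _ (G : groupType) (N : normalClosed G) :=
  isMultiplicative.Build G (quotg N) (\pi_(quotg N))%qT
    (@pi_quotg_multiplicative G N).

Section Quotients.
Local Open Scope quotient_scope.
Variables (G : groupType) (N : normalClosed G).

Lemma eq_pi_quotg x y : \pi_(quotg N) x = \pi_(quotg N) y <-> x^-1 * y \in N.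
Proof. by split=> [/eqP|]; [|move=> xy; apply/eqP]; rewrite eq_quotg. Qed.

End Quotients.

Lemma lcs_le (G : groupType) m n : (m <= n)%N -> {subset lcs G n <= lcs G m}.
Proof.
move=> /subnK <-; elim: (n - m)%N => [//|d IHd] x; rewrite addSn.
by move=> /lcs_sub; apply: IHd.
Qed.

Lemma lcs_morph (G H : groupType) (f : {multiplicative G -> H}) n x :
  x \in lcs G n -> f x \in lcs H n.
Proof.
elim: n x => [//|n IHn] x.
pose S : {pred G} := fun x => f x \in lcs H n.+1.
have SE y : (y \in S) = (f y \in lcs H n.+1) by [].
have S1 : 1 \in S by rewrite SE multiplicative1 gpred1.
have SM : mulg_closed S.
  by move=> y z; rewrite !SE gmulfM => fy fz; apply: gpredM.
have SV : invg_closed S by move=> y; rewrite !SE multiplicativeV gpredV.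
move=> /(generated_ind S1 SM SV); apply=> _ /asboolP[y [z [yn _ ->]]].
by rewrite SE multiplicativeR; apply: lcs_comm; apply: IHn.
Qed.

Section Threads.
Local Open Scope quotient_scope.
Variable F : groupType.
Implicit Types w : pronilpotent_completion F.

Lemma thread_le w m n x :
  (m <= n)%N -> w n = \pi_(lcs_quot F n) x -> w m = \pi_(lcs_quot F m) x.
Proof.
move=> /subnK <-; elim: (n - m)%N => [//|d IHd]; rewrite addSn => wx.
apply: IHd; rewrite -(invlimE w) wx; apply: quotg_mapE; exact: lcs_sub.
Qed.

Definition cauchy (s : nat -> F) := forall n, (s n)^-1 * s n.+1 \in lcs F n.

Lemma cauchy_compatible s : cauchy s ->
  compatible (@lcs_proj F) (fun n => \pi_(lcs_quot F n) (s n)).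
Proof.
move=> sc; apply/asboolP => n; apply: etrans (quotg_mapE (@lcs_sub F n) _) _.
by apply/esym/eq_pi_quotg/sc.
Qed.

Definition limit s (sc : cauchy s) : pronilpotent_completion F :=
  InvLim (cauchy_compatible sc).

Variables (k : fieldType) (Phi : {multiplicative F -> lamp k}).

(* [Phi] maps gamma_(n+1)(F) into x^n k[[x]], hence the n-th coefficient can be
   read off any representative modulo gamma_(n+2)(F). *)
Definition hat w : lamp k :=
  ((Phi (repr (w 1%N))).1, fun n => (Phi (repr (w n.+1))).2 n).

Lemma hatE w n x : w n = \pi_(lcs_quot F n) x ->
  ((0 < n)%N -> (hat w).1 = (Phi x).1) /\
  forall i, (i < n)%N -> (hat w).2 i = (Phi x).2 i.
Proof.
move=> wx.
have repr_deep m : (m <= n)%N -> exists2 y, repr (w m) = x * y & deep m (Phi y).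
  move=> mn; rewrite (thread_le mn wx); have [y ym ->] := repr_quotg (lcs F m) x.
  by exists y => //; apply/lcs_deep/lcs_morph.
split=> [n0|i ni] /=.
  by have [y -> [y1 _]] := repr_deep _ n0; rewrite gmulfM lampME y1 //= addr0.
have [y -> [y1 y2]] := repr_deep _ ni.
by rewrite gmulfM lampME y1 //= pserDE y2 // addr0.
Qed.

Lemma hat_limit w s : (forall n, w n = \pi_(lcs_quot F n) (s n)) ->
  hat w = ((Phi (s 1%N)).1, fun n => (Phi (s n.+1)).2 n).
Proof.
move=> ws; apply/eqP; rewrite -pair_eqE; apply/andP; split; apply/eqP.
  by rewrite (hatE (ws 1%N)).1.
by apply/funext => n; rewrite (hatE (ws n.+1)).2.
Qed.

Lemma hatM : {morph hat : w w' / w * w'}.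
Proof.
move=> w w'.
have ww n : (w * w') n = \pi_(lcs_quot F n) (repr (w n) * repr (w' n)).
  by rewrite [RHS](pi_quotg_multiplicative (lcs F n)) !reprK.
have wE n := @hatE w n _ (esym (reprK (w n))).
have w'E n := @hatE w' n _ (esym (reprK (w' n))).
have wwE n := @hatE (w * w') n _ (ww n).
apply/eqP; rewrite -pair_eqE; apply/andP; split; apply/eqP.
  by rewrite (wwE 1%N).1 // gmulfM !lampM1E (wE 1%N).1 // (w'E 1%N).1.
apply/funext => i; rewrite (wwE i.+1).2 // gmulfM !lampM2E.
rewrite (w'E i.+1).2 // (w'E i.+1).1 //; congr (_ + _)%R.
(* Coefficient i of [zact] depends only on the coefficients up to i, since x^(i+1) k[[x]] is
   stable. *)
apply/eqP; rewrite -subr_eq0; apply/eqP.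
rewrite -[LHS]/((zact _ _ - zact _ _) i)%R -raddfB.
apply: (@low_zero_zact _ i.+1) => // j ji.
by rewrite pserDE pserNE (wE i.+1).2 // subrr.
Qed.

HB.instance Definition _ :=
  isMultiplicative.Build (pronilpotent_completion F) (lamp k) hat hatM.

End Threads.

(** * Commutator expansions in a 2-generated group *)

Lemma lcs_central (G : groupType) n (x y : G) : x \in lcs G n ->
  commute (\pi_(quotg (lcs G n.+1)) x)%qT (\pi_(quotg (lcs G n.+1)) y)%qT.
Proof.
move=> xn; rewrite /commute -!gmulfM; apply/esym/eq_pi_quotg.
by rewrite invgM -mulgA -[y^-1 * _]/(x ^ y) lcs_comm.
Qed.

Lemma commMgl (G : groupType) (x y z : G) : commute [~ x, z] y ->
  [~ x * y, z] = [~ x, z] * [~ y, z].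
Proof.
move=> xzy; have -> : [~ x * y, z] = [~ x, z] ^ y * [~ y, z].
  by rewrite /commg /conjg !invgM !mulgA !mulgK.
by rewrite /conjg xzy mulKg.
Qed.

Lemma commMgr (G : groupType) (x y z : G) : commute [~ x, z] y ->
  commute [~ x, z] [~ x, y] ->
  [~ x, z * y] = [~ x, z] * [~ x, y].
Proof.
move=> xzy xzxy; have -> : [~ x, z * y] = [~ x, y] * [~ x, z] ^ y.
  by rewrite /commg /conjg !invgM !mulgA !mulgK.
by rewrite /conjg xzy mulKg xzxy.
Qed.

Lemma commuteR (G : groupType) (z x y : G) :
  commute z x -> commute z y -> commute z [~ x, y].
Proof.
move=> zx zy; apply: commuteM; first exact: commuteV.
by apply: commuteM; [apply: commuteV | apply: commuteM].
Qed.

Lemma comm_mul_central (G : groupType) (x y c c' : G) :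
  commute c x -> commute c y -> commute c' x -> commute c' y ->
  commute c c' -> [~ x * c, y * c'] = [~ x, y].
Proof.
move=> cx cy c'x c'y cc'.
have xc' : [~ x, c'] = 1 by apply/eqP/commgP/commute_sym.
have c_yc' : [~ c, y * c'] = 1 by apply/eqP/commgP/commuteM.
rewrite commMgl; last by apply/commute_sym/commuteR => //; apply: commuteM.
rewrite c_yc' mulg1 commMgr ?xc' ?mulg1 //; last exact: commute1.
by apply/commute_sym/commuteR.
Qed.

Section TwoGenerated.
Variables (E : groupType) (a b : E).
Hypothesis gen_ab : forall x, x \in generated (pred2 a b).

Section OneStep.
Variable n : nat.
Let Q := quotg (lcs E n.+2).
Let pi : {multiplicative E -> Q} := (\pi_Q)%qT.

Let piC x y : x \in lcs E n.+1 -> commute (pi x) (pi y).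
Proof. exact: lcs_central. Qed.

Definition ab_comm : {pred Q} :=
  fun q => `[< exists u v, [/\ u \in lcs E n, v \in lcs E n
                            & q = pi [~ u, a] * pi [~ v, b]] >].

Lemma quot_commMl z u v : u \in lcs E n ->
  pi [~ u * v, z] = pi [~ u, z] * pi [~ v, z].
Proof.
move=> un; rewrite !multiplicativeR gmulfM commMgl //.
by rewrite -multiplicativeR; apply/piC/lcs_comm.
Qed.

Fact ab_comm1 : 1 \in ab_comm.
Proof.
apply/asboolP; exists 1, 1; split; try exact: gpred1.
by rewrite !comm1g multiplicative1 mulg1.
Qed.

Fact ab_commM : mulg_closed ab_comm.
Proof.
move=> _ _ /asboolP[u [v [un vn ->]]] /asboolP[u' [v' [un' vn' ->]]].
apply/asboolP; exists (u * u'), (v * v'); split; try exact: gpredM.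
rewrite !quot_commMl // -!mulgA; congr (_ * _); rewrite !mulgA; congr (_ * _).
by apply: piC; apply: lcs_comm.
Qed.

Fact ab_commV : invg_closed ab_comm.
Proof.
move=> _ /asboolP[u [v [un vn ->]]]; apply/asboolP; exists u^-1, v^-1.
split; try by rewrite gpredV.
have commV z w : w \in lcs E n -> pi [~ w^-1, z] = (pi [~ w, z])^-1.
  move=> wn; apply: (mulgI (pi [~ w, z])); rewrite -quot_commMl //.
  by rewrite mulgV comm1g multiplicative1 mulgV.
rewrite !commV // invgM; apply: commuteV; apply/commute_sym/commuteV.
by apply: piC; apply: lcs_comm.
Qed.

HB.instance Definition _ := isMulClosed.Build Q ab_comm ab_commM.
HB.instance Definition _ := isMul1Closed.Build Q ab_comm ab_comm1.
HB.instance Definition _ := isInvClosed.Build Q ab_comm ab_commV.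

(** For z in gamma_(n+1), f -> [z, f] is a homomorphism modulo gamma_(n+3), so it suffices to take f
    = a and f = b. *)
Lemma comm_ab_comm z f : z \in lcs E n -> pi [~ z, f] \in ab_comm.
Proof.
move=> zn; pose S : {pred E} := fun f => pi [~ z, f] \in ab_comm.
have SE y : (y \in S) = (pi [~ z, y] \in ab_comm) by [].
have zC y x : commute (pi [~ z, y]) (pi x) by apply/piC/lcs_comm.
have zM x y : pi [~ z, x * y] = pi [~ z, x] * pi [~ z, y].
  rewrite !multiplicativeR gmulfM commMgr // -multiplicativeR //.
  by rewrite -multiplicativeR; apply: zC.
have S1 : 1 \in S by rewrite SE commg1 multiplicative1 gpred1.
have SM : mulg_closed S by move=> x y; rewrite !SE zM; apply: gpredM.
have SV : invg_closed S.
  move=> x; rewrite !SE; have -> : pi [~ z, x^-1] = (pi [~ z, x])^-1.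
    apply: (mulgI (pi [~ z, x])).
    by rewrite -zM mulgV commg1 multiplicative1 mulgV.
  by rewrite gpredV.
apply: (generated_ind S1 SM SV) (gen_ab f) => _ /orP[] /eqP->; apply/asboolP.
- by exists z, 1; rewrite comm1g multiplicative1 mulg1 gpred1.
- by exists 1, z; rewrite comm1g multiplicative1 mul1g gpred1.
Qed.

Lemma lcs_ab_comm x : x \in lcs E n.+1 ->
  exists u v, [/\ u \in lcs E n, v \in lcs E n
                & ([~ u, a] * [~ v, b])^-1 * x \in lcs E n.+2].
Proof.
pose S : {pred E} := fun x => pi x \in ab_comm.
have SE y : (y \in S) = (pi y \in ab_comm) by [].
have S1 : 1 \in S by rewrite SE multiplicative1 gpred1.
have SM : mulg_closed S by move=> y z; rewrite !SE gmulfM; apply: gpredM.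
have SV : invg_closed S by move=> y; rewrite !SE multiplicativeV gpredV.
move=> /(generated_ind S1 SM SV) xS; have /asboolP[u [v [un vn xE]]] : x \in S.
  apply: xS => _ /asboolP[y [z [yn _ ->]]]; exact: comm_ab_comm.
by exists u, v; split=> //; apply/eq_pi_quotg; rewrite xE -gmulfM.
Qed.

End OneStep.

(* The residual of [W n] is corrected by new factors multiplied on the left of
   [U n] and [V n], so that only centrality of gamma_(n+3) modulo gamma_(n+4)
   is needed, and not the relation [gamma_i, gamma_j] <= gamma_(i+j). *)
Lemma lcs_ab_series (W : nat -> E) :
  W 0%N \in lcs E 2 -> (forall n, (W n)^-1 * W n.+1 \in lcs E n.+3) ->
  exists U V : nat -> E, [/\ forall n, U n \in lcs E 1,
    forall n, (U n)^-1 * U n.+1 \in lcs E n.+1,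
    forall n, (V n)^-1 * V n.+1 \in lcs E n.+1
    & forall n, ([~ U n, a] * [~ V n, b])^-1 * W n \in lcs E n.+2].
Proof.
move=> W0 WS.
(* The implication makes the choice total: outside gamma_(n+2) the pair (1, 1) is a default. *)
have step n x : {uv : E * E | x \in lcs E n.+1 -> [/\ uv.1 \in lcs E n,
    uv.2 \in lcs E n & ([~ uv.1, a] * [~ uv.2, b])^-1 * x \in lcs E n.+2]}.
  apply: cid; have [/lcs_ab_comm[u [v uv]]|//] := boolP (x \in lcs E n.+1).
    by exists (u, v).
  by exists (1, 1).
pose res (uv : E * E) w := ([~ uv.1, a] * [~ uv.2, b])^-1 * w.
(* For n = m + 1 the residual of [W n] against the pair of index m lies in gamma_(m+3), and the
   correction [d] removes it modulo gamma_(m+4). *)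
pose uv := fix uv n : E * E := if n is m.+1 then
  let d := sval (step n (res (uv m) (W n))) in (d.1 * (uv m).1, d.2 * (uv m).2)
  else (1, 1).
pose d n := sval (step n.+1 (res (uv n) (W n.+1))).
have uvS n : uv n.+1 = ((d n).1 * (uv n).1, (d n).2 * (uv n).2) by [].
have resP n : res (uv n) (W n) \in lcs E n.+2 ->
    [/\ (d n).1 \in lcs E n.+1, (d n).2 \in lcs E n.+1
      & res (d n) (res (uv n) (W n.+1)) \in lcs E n.+3].
  move=> rn; apply: (svalP (step n.+1 (res (uv n) (W n.+1)))).
  rewrite /res -[W n.+1](mulVKg (W n)) mulgA; apply: gpredM => //.
  exact: lcs_sub (WS n).
have resE n : res (uv n) (W n) \in lcs E n.+2.
  elim: n => [|n IHn]; first by rewrite /res /= !comm1g mulg1 invg1 mul1g.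
  have [d1 d2 dr] := resP n IHn.
  rewrite -[res _ _]/(([~ (d n).1 * (uv n).1, a]
    * [~ (d n).2 * (uv n).2, b])^-1 * W n.+1).
  move: dr; rewrite /res mulgA -invgM => /eq_pi_quotg dr.
  have dC x y : x \in lcs E n.+2 -> _ := @lcs_central E n.+2 x y.
  apply/eq_pi_quotg; rewrite -{}dr [LHS]gmulfM !quot_commMl // [RHS]gmulfM.
  rewrite [X in _ = X * _]gmulfM [X in _ = _ * X]gmulfM.
  rewrite (dC _ [~ (uv n).1, a]) ?lcs_comm // -!mulgA; congr (_ * _).
  have := dC ([~ (d n).1, a] * [~ (d n).2, b]) [~ (uv n).2, b].
  rewrite [X in commute X _]gmulfM => dvC; rewrite -dvC; first by rewrite mulgA.
  by apply: gpredM; apply: lcs_comm.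
have dP n := resP n (resE n).
(* A new left factor d changes u by the right factor d^u, which normality keeps in gamma_(n+2). *)
have dJ n x y : x \in lcs E n.+1 -> y^-1 * (x * y) \in lcs E n.+1.
  exact: lcsJ.
exists (fun n => (uv n).1), (fun n => (uv n).2); split=> // n.
- elim: n => [|n IHn]; first exact: gpred1.
  rewrite uvS; apply: gpredM => //; have [dn _ _] := dP n.
  exact: lcs_le dn.
- by rewrite uvS; apply: dJ; have [] := dP n.
- by rewrite uvS; apply: dJ; have [] := dP n.
Qed.

End TwoGenerated.

(** * Classes of convergent products of commutators *)

Definition indic (k : fieldType) (e : pred nat) : pser k := fun i => (e i)%:R%R.

Lemma cocycle2_comp (G H : groupType) (V : zmodType) (c : H -> H -> V)
    (f : {multiplicative G -> H}) :
  cocycle2 c -> cocycle2 (fun x y => c (f x) (f y)).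
Proof. by move=> cc x y z; rewrite !gmulfM cc. Qed.

Section IteratedCommutators.
Variables (E : groupType) (a b : E).

Fixpoint iter_comm n : E := if n is m.+1 then [~ iter_comm m, b] else a.

Fixpoint indic_prod (e : pred nat) n : E :=
  if n is m.+1 then indic_prod e m * (if e m then iter_comm m else 1) else 1.

Lemma iter_comm_lcs n : iter_comm n \in lcs E n.
Proof. by elim: n => [//|n IHn]; apply: lcs_comm. Qed.

Lemma indic_prod_lcs (e : pred nat) n :
  (if e n then iter_comm n else 1) \in lcs E n.
Proof. by case: (e n); rewrite ?iter_comm_lcs ?gpred1. Qed.

Lemma indic_prod2_lcs (e : pred nat) : ~~ e 0%N -> indic_prod e 2 \in lcs E 1.
Proof.
move=> /negPf e0; have -> : indic_prod e 2 = if e 1%N then iter_comm 1 else 1.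
  by rewrite /= e0 !mul1g.
exact: indic_prod_lcs.
Qed.

Variables (k : fieldType) (f : {multiplicative E -> lamp k}).
Hypotheses (fa : f a = (0, indic k (pred1 0%N))%R) (fb : f b = (1, 0)%R).

(** Commutation with b acts on M as t - 1, which is multiplication by x; so the image is x^n. *)
Lemma iter_comm_lamp n : f (iter_comm n) = (0, indic k (pred1 n))%R.
Proof.
elim: n => [//|n IHn] /=; rewrite multiplicativeR IHn fb lampRE; congr pair.
rewrite raddf0 subr0 subr0 /= addrC; apply/funext => i.
rewrite pserDE pserNE /unip addrA addNr add0r.
by case: i => //.
Qed.

Lemma indic_prod_lamp (e : pred nat) n :
  f (indic_prod e n) = (0, indic k (fun i => (i < n)%N && e i))%R.
Proof.
elim: n => [|n IHn] /=; first by rewrite multiplicative1; congr pair; apply/funext.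
rewrite gmulfM IHn.
have -> : f (if e n then iter_comm n else 1) =
    (0, indic k (fun i => (i == n) && e i))%R.
  case: ifP => en; first rewrite iter_comm_lamp; last rewrite multiplicative1.
    by congr pair; apply/funext => i; rewrite /indic /=; case: eqP => // ->;
      rewrite en.
  by congr pair; apply/funext => i; rewrite /indic /=; case: eqP => // ->;
    rewrite en.
rewrite lampME /= addr0; congr pair; apply/funext => i.
rewrite pserDE /= /indic -natrD.
by rewrite ltnS; case: ltngtP => //= _; case: (e i).
Qed.

End IteratedCommutators.

Section Classes.
Variables (E F : groupType) (a b : E) (j : {multiplicative E -> F}).
Hypothesis gen_ab : forall x, x \in generated (pred2 a b).

Lemma cauchy_morph (s : nat -> E) :
  (forall n, (s n)^-1 * s n.+1 \in lcs E n) -> cauchy (j \o s).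
Proof. by move=> sc n /=; rewrite -multiplicativeV -gmulfM lcs_morph. Qed.

(** The class of [A_e, A_e'] = [U, a][V, b] in the completion. All these commutators have trivial
    image, and the terms of (U, a) and (V, b) vanish since phi and psi kill the image of a and b has
    zero component in M. *)
Lemma lamp_class (e e' : pred nat) : ~~ e 0%N -> ~~ e' 0%N ->
  exists h : group_homology (pronilpotent_completion F) 2,
    forall (k : fieldType) (Phi : {multiplicative F -> lamp k}),
      Phi (j a) = (0, indic k (pred1 0%N))%R -> Phi (j b) = (1, 0)%R ->
    forall (K : fieldType) (phi psi : pser k -> K) (T : K),
      {morph phi : x y / (x + y)%R} -> {morph psi : x y / (x + y)%R} ->
      (T != 0)%R -> (forall m, phi (unip m) = T * phi m)%R ->
      (forall m, psi (unip m) = T^-1 * psi m)%R ->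
      phi (indic k (pred1 0%N)) = 0%R -> psi (indic k (pred1 0%N)) = 0%R ->
      pairing (fun x y => lamp_cocycle phi psi (hat Phi x) (hat Phi y)) h =
        (phi (indic k e) * psi (indic k e') - phi (indic k e') * psi (indic k e))%R.
Proof.
move=> e0 e'0.
(* The shift by two puts [W 0] in gamma_3 and makes the factor from [H n] to [H n.+1] lie in
   gamma_(n+3), hence central modulo gamma_(n+4). *)
pose H n := indic_prod a b e n.+2; pose H' n := indic_prod a b e' n.+2.
have HS (d : pred nat) n :
    (indic_prod a b d n)^-1 * indic_prod a b d n.+1 \in lcs E n.
  by rewrite /= mulKg indic_prod_lcs.
pose W n := [~ H n, H' n].
have W0 : W 0%N \in lcs E 2 by apply: lcs_comm; apply: indic_prod2_lcs.
have WS n : (W n)^-1 * W n.+1 \in lcs E n.+3.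
  apply/eq_pi_quotg; rewrite /W.
  have [c cn ->] : exists2 c, c \in lcs E n.+2 & H n.+1 = H n * c.
    by exists ((H n)^-1 * H n.+1); rewrite ?mulVKg //; apply: HS.
  have [c' c'n ->] : exists2 c, c \in lcs E n.+2 & H' n.+1 = H' n * c.
    by exists ((H' n)^-1 * H' n.+1); rewrite ?mulVKg //; apply: HS.
  have central := @lcs_central E n.+2.
  move: (H n) (H' n) => x y.
  by rewrite !multiplicativeR !gmulfM comm_mul_central //; apply: central.
have [U [V [U1 US VS UV]]] := lcs_ab_series gen_ab W0 WS.
have lim_of (s : nat -> E) : (forall n, (s n)^-1 * s n.+1 \in lcs E n) ->
    exists w : pronilpotent_completion F,
      forall n, w n = (\pi_(lcs_quot F n) (j (s n)))%qT.
  by move=> sc; exists (limit (cauchy_morph sc)).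
have HS2 (d : pred nat) n :
    (indic_prod a b d n.+2)^-1 * indic_prod a b d n.+3 \in lcs E n.
  by apply: (@lcs_le _ _ n.+2); [do 2!apply: leqW | apply: HS].
have [h hE] := lim_of H (HS2 e).
have [h' h'E] := lim_of H' (HS2 e').
have [|u uE] := lim_of U; first by move=> n; apply: lcs_le (US n).
have [|v vE] := lim_of V; first by move=> n; apply: lcs_le (VS n).
have [|ha haE] := lim_of (fun=> a); first by move=> n; rewrite mulVg gpred1.
have [|hb hbE] := lim_of (fun=> b); first by move=> n; rewrite mulVg gpred1.
have rel : [~ h, h'] = [~ u, ha] * [~ v, hb].
  apply: invlim_eq => n.
  rewrite -[LHS]/[~ h n, h' n] -[RHS]/([~ u n, ha n] * [~ v n, hb n]).
  rewrite hE h'E uE vE haE hbE -!multiplicativeR -gmulfM.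
  apply/esym/eq_pi_quotg; rewrite -gmulfM -multiplicativeV -gmulfM.
  by apply: lcs_morph; apply: lcs_le (UV n); apply/leqW.
have [x xP] := comm_relation_class rel; exists x => k Phi Pa Pb K phi psi T.
move=> phiD psiD T0 phiT psiT phi0 psi0.
pose f := [the {multiplicative pronilpotent_completion F -> lamp k} of hat Phi].
have cc := cocycle2_comp f (lamp_cocycleP phiD psiD T0 phiT psiT).
have fprod (w : pronilpotent_completion F) (d : pred nat) :
    (forall n, w n = (\pi_(lcs_quot F n) (j (indic_prod a b d n.+2)))%qT) ->
    f w = (0, indic k d)%R.
  move=> wE; have PE n := @indic_prod_lamp _ _ _ _ (Phi \o j) Pa Pb d n.
  rewrite /f /= (hat_limit Phi wE); rewrite /= in PE; congr pair.
    by rewrite PE.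
  by apply/funext => i; rewrite PE /indic /= ltnS -addn2 leq_addr.
have fh : f h = (0, indic k e)%R by apply: fprod.
have fh' : f h' = (0, indic k e')%R by apply: fprod.
have fha : f ha = (0, indic k (pred1 0%N))%R.
  by rewrite /f /= (hat_limit Phi haE) Pa.
have fhb : f hb = (1, 0)%R by rewrite /f /= (hat_limit Phi hbE) Pb.
(* U lies in the derived subgroup, so its image lies in M and commutes with that of a; the relation
   then makes [V, b] trivial as well. *)
have fu : (f u).1 = 0%R.
  have [-> // _] := hatE Phi (uE 1%N).
  by have [->] := lcs_deep (lcs_morph (Phi \o j) (U1 1%N)).
rewrite -[LHS]/(pairing (fun x y => lamp_cocycle phi psi (f x) (f y)) x).
have := xP K _ cc; cbv beta zeta; move=> ->.
clearbody f.
have phi00 : phi 0%R = 0%R by apply: (addrI (phi 0%R)); rewrite -phiD !addr0.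
have psi00 : psi 0%R = 0%R by apply: (addrI (psi 0%R)); rewrite -psiD !addr0.
have comm0 (m n : pser k) : [~ (0, m)%R : lamp k, (0, n)%R : lamp k] = (0, 0)%R.
  by rewrite lampRE /= !subrr.
have fhh' : f [~ h, h'] = (0, 0)%R by rewrite multiplicativeR fh fh' comm0.
move: fu; case fuE: (f u) => [iu mu] /= iu0; rewrite {}iu0 in fuE *.
have fuha : f [~ u, ha] = (0, 0)%R by rewrite multiplicativeR fuE fha comm0.
have fvhb : f [~ v, hb] = (0, 0)%R.
  rewrite -[LHS]mul1g; have := congr1 f rel.
  by rewrite fhh' gmulfM fuha => /esym; apply.
rewrite fhh' fuha fvhb ![f (_ * _)]gmulfM fh fh' fuE fha fhb.
case: (f v) => [iv mv]; rewrite /lamp_cocycle !lampME /= !psi00 !raddf0 !phi00.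
by rewrite phi0 psi0 !mulr0 !mul0r !subr0.
Qed.

End Classes.

Local Close Scope group_scope.
Local Open Scope ring_scope.

(** * Functionals on power series *)

(* A maximal submodule avoiding the nonzero multiples of [v]: modulo it every
   vector becomes proportional to [v], and the ratio is the functional. *)
Section Functional.
Variables (R : idomainType) (V : lmodType R) (K : fieldType).
Variables (iota : {rmorphism R -> K}) (N : {pred V}) (v : V).
Hypotheses (iota_inj : injective iota).
Hypotheses (N0 : 0 \in N) (ND : {in N &, forall m n, m + n \in N}).
Hypotheses (NZ : forall a, {in N, forall m, a *: m \in N}).
Hypotheses (Nv : forall a, a *: v \in N -> a = 0).

Definition avoids (S : set V) : Prop :=
  [/\ forall m, m \in N -> S m, forall m n, S m -> S n -> S (m + n),
      forall a m, S m -> S (a *: m) & forall a, S (a *: v) -> a = 0].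

Lemma exists_functional : exists phi : V -> K,
  [/\ {morph phi : m n / m + n}, forall a m, phi (a *: m) = iota a * phi m,
      forall m, m \in N -> phi m = 0 & phi v = 1].
Proof.
(* [N] is adjoined so that the empty chain, whose union is empty, still satisfies [P]. *)
pose P (S : set V) := avoids (fun m => S m \/ m \in N).
have [F FP Ftot|S [[SN SD SZ Sv] Smax]] := @Zorn_bigcup V P.
  have two m n : (\bigcup_(X in F) X)%classic m \/ m \in N ->
      (\bigcup_(X in F) X)%classic n \/ n \in N ->
      (exists2 X, F X & (X m \/ m \in N) /\ (X n \/ n \in N)) \/
      (m \in N /\ n \in N).
    move=> [[X FX Xm]|mN] [[Y FY Yn]|nN]; last by right.
    - left; have [XY|YX] := Ftot _ _ FX FY.
        by exists Y => //; split; left=> //; apply: XY.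
      by exists X => //; split; left=> //; apply: YX.
    - by left; exists X => //; split; [left | right].
    - by left; exists Y => //; split; [right | left].
  split=> [m mN|m n mF nF|a m mF|a aF].
  - by right.
  - have [[X FX [Xm Xn]]|[mN nN]] := two m n mF nF; last by right; apply: ND.
    have [_ XD _ _] := FP _ FX.
    by have [XDmn|] := XD _ _ Xm Xn; [left; exists X | right].
  - have [[X FX [Xm _]]|[mN _]] := two m m mF mF; last by right; apply: NZ.
    have [_ _ XZ _] := FP _ FX.
    by have [XZm|] := XZ a _ Xm; [left; exists X | right].
  - have [[X FX [Xv _]]|[vN _]] := two _ _ aF aF; last exact: Nv.
    by have [_ _ _] := FP _ FX; apply.
pose S' m := S m \/ m \in N; rewrite -/S' in SN SD SZ Sv.
have S0 : S' 0 by right.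
(* Otherwise S' + R m would be a strictly larger submodule avoiding the nonzero multiples of [v]. *)
have ratio m : {ab : R * R | ab.1 != 0 /\ S' (ab.1 *: m - ab.2 *: v)}.
  apply: cid; apply: contrapT => no_ratio.
  have Sm : ~ S' m.
    move=> mS; apply: no_ratio; exists (1, 0).
    by rewrite oner_eq0 scale1r scale0r subr0.
  pose B n := exists (c : R) s, S' s /\ n = s + c *: m.
  apply: (Smax B).
    split=> [n Sn|BS].
      by exists 0, n; rewrite scale0r addr0; split=> //; left.
    apply: Sm; left; apply: BS; exists 1, 0; rewrite scale1r add0r; split=> //.
  have BN n : B n \/ n \in N -> B n.
    by case=> // nN; exists 0, n; rewrite scale0r addr0; split=> //; right.
  split=> [n nN|n n' /BN[c [s [sS ->]]] /BN[c' [s' [sS' ->]]]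
          |a n /BN[c [s [sS ->]]]|a /BN[c [s [sS avE]]]].
  - by right.
  - left; exists (c + c'), (s + s'); split; first exact: SD.
    by rewrite scalerDl addrACA.
  - left; exists (a * c), (a *: s); split; first exact: SZ.
    by rewrite scalerDr scalerA.
  - have [c0|c0] := eqVneq c 0.
      by apply: Sv; rewrite avE c0 scale0r addr0.
    case: no_ratio; exists (c, a); split=> //=.
    by rewrite avE opprD addrCA subrr addr0 -scaleN1r; apply: SZ.
pose num m := (sval (ratio m)).2; pose den m := (sval (ratio m)).1.
have den0 m : den m != 0 by have [] := svalP (ratio m).
have numden m : S' (den m *: m - num m *: v) by have [] := svalP (ratio m).
pose phi m := iota (num m) / iota (den m).
have iota0 a : a != 0 -> iota a != 0.
  by apply: contra_neq => a0; apply: iota_inj; rewrite a0 rmorph0.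
(* The value is independent of the ratio: cross-multiplying two ratios gives a multiple of [v] in
   S', which must be 0. *)
have phiP a b m : a != 0 -> S' (a *: m - b *: v) -> phi m = iota b / iota a.
  move=> a0 abS; apply/eqP; rewrite eqr_div ?iota0 // -!rmorphM /=; apply/eqP.
  congr (iota _); apply/eqP; rewrite -subr_eq0; apply/eqP/Sv.
  have -> : (num m * a - b * den m) *: v =
      den m *: (a *: m - b *: v) + (- a) *: (den m *: m - num m *: v).
    rewrite !scalerBr !scalerA scalerBl !mulNr !scaleNr opprK.
    rewrite [a * den m]mulrC [a * num m]mulrC [den m * b]mulrC.
    by rewrite addrACA subrr add0r addrC.
  exact: SD (SZ _ _ abS) (SZ _ _ (numden m)).
exists phi; split=> [m n|a m|m mN|].
- rewrite (phiP (den m * den n) (den n * num m + den m * num n)).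
  + by rewrite rmorphD !rmorphM /phi /=; field; rewrite !iota0 ?den0.
  + by rewrite mulf_neq0.
  have -> : (den m * den n) *: (m + n) - (den n * num m + den m * num n) *: v
     = den n *: (den m *: m - num m *: v) + den m *: (den n *: n - num n *: v).
    rewrite !scalerBr !scalerA scalerDr scalerDl [den m * den n]mulrC.
    by rewrite opprD addrACA [den n * den m]mulrC.
  exact: SD (SZ _ _ (numden m)) (SZ _ _ (numden n)).
- rewrite (phiP (den m) (a * num m)) // ?rmorphM ?mulrA //=.
  by rewrite scalerA mulrC -!scalerA -scalerBr; exact: SZ (numden m).
- rewrite (phiP 1 0) ?oner_eq0 // ?rmorph0 ?mul0r //.
  by rewrite scale1r scale0r subr0; right.
- rewrite (phiP 1 1) ?oner_eq0 // ?rmorph1 ?divr1 //.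
  by rewrite !scale1r subrr.
Qed.

End Functional.

Section Spikes.
Local Open Scope nat_scope.

(** Enumerates the positive integers of 2-adic valuation q. *)
Definition spike_exp q i := 2 ^ q * i.*2.+1.

(* The indicators of pairwise disjoint infinite sets of powers of 2: the support
   of [spike q] consists of the 2^l with l > 0 and 2-adic valuation of l equal
   to q. *)
Definition spike q : pred nat :=
  fun j => [&& 0 < trunc_log 2 j, j == 2 ^ trunc_log 2 j
             & logn 2 (trunc_log 2 j) == q].

Lemma spikeP q j : spike q j -> exists l, j = 2 ^ l /\ logn 2 l = q.
Proof. by case/and3P => _ /eqP jE /eqP lE; exists (trunc_log 2 j). Qed.

Lemma spike0 q : ~~ spike q 0. Proof. by []. Qed.

Lemma spike_at q i : spike q (2 ^ spike_exp q i).
Proof.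
rewrite /spike trunc_expnK // eqxx /spike_exp muln_gt0 expn_gt0 /=.
rewrite lognM ?expn_gt0 // pfactorK // (@logn_coprime 2) ?addn0 //.
by rewrite coprime2n /= odd_double.
Qed.

Lemma logn_spike_exp q i : logn 2 (spike_exp q i) = q.
Proof.
by have /spikeP[l [/eqP]] := spike_at q i; rewrite eqn_exp2l // => /eqP ->.
Qed.

Lemma spike_exp_ge q i d : d <= i -> d < 2 ^ (spike_exp q i).-1.
Proof.
move=> di; apply: (leq_trans (ltn_expl d (ltnSn 1))).
rewrite leq_exp2l //; apply: (leq_trans di).
have : 1 <= 2 ^ q by rewrite expn_gt0.
by rewrite /spike_exp; move: (2 ^ q) => x; nia.
Qed.

(** Any other power of 2 is at distance at least 2^(n-1) > d from 2^n, where n = [spike_exp q i]. *)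
Lemma spike_near q q' i j d : d <= i ->
  2 ^ spike_exp q i <= j + d -> j <= 2 ^ spike_exp q i + d ->
  spike q' j -> q' = q /\ j = 2 ^ spike_exp q i.
Proof.
move=> /(spike_exp_ge q) di lo hi /spikeP[l [jE lE]].
suff ln : l = spike_exp q i by rewrite -lE jE ln logn_spike_exp.
have n0 : 0 < spike_exp q i by rewrite muln_gt0 expn_gt0.
move: (spike_exp q i) n0 di lo hi => n; case: n => // n _ /= di.
rewrite {}jE expnS mul2n -addnn => lo hi; case: (ltngtP l n.+1) => // ln; exfalso.
  have : 2 ^ l <= 2 ^ n by rewrite leq_exp2l.
  by move: (2 ^ l) (2 ^ n) di lo hi => x y; lia.
have : 2 ^ n.+2 <= 2 ^ l by rewrite leq_exp2l.
by rewrite !expnS; move: (2 ^ l) (2 ^ n) di lo hi => x y; lia.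
Qed.

End Spikes.

Section SpikeFunctionals.
Variables (k K : fieldType) (iota : {rmorphism {poly k} -> K}).
Hypothesis iota_inj : injective iota.

(** Every radius [d] is allowed, at the cost of finitely many spikes, so that the set is stable
    under polynomials: a factor P widens the windows by its degree. *)
Definition zero_near_spikes q : {pred pser k} := fun m =>
  `[< forall d : nat, exists i0 : nat, forall i, (i0 <= i)%N ->
      forall j, (2 ^ spike_exp q i <= j + d)%N ->
                (j <= 2 ^ spike_exp q i + d)%N -> m j = 0 >].

Lemma zero_near_spikesD q :
  {in zero_near_spikes q &, forall m n, m + n \in zero_near_spikes q}.
Proof.
move=> m n /asboolP m0 /asboolP n0; apply/asboolP => d.
have [i1 m1] := m0 d; have [i2 n2] := n0 d; exists (maxn i1 i2) => i.
rewrite geq_max => /andP[i1i i2i] j lo hi.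
by rewrite pserDE (m1 i) // (n2 i) // addr0.
Qed.

Lemma zero_near_spikesZ q (P : {poly k}) :
  {in zero_near_spikes q, forall m, P *: m \in zero_near_spikes q}.
Proof.
move=> m /asboolP m0; apply/asboolP => d.
have [i0 mi] := m0 (d + size P)%N; exists i0 => i ii0 j lo hi.
rewrite -[LHS]/(\sum_(l < j.+1) P`_l * m (j - l)%N) big1 // => l _.
case: (ltnP l (size P)) => lP; last by rewrite nth_default ?mul0r.
by rewrite (mi i) ?mulr0 //; have := ltn_ord l; lia.
Qed.

Lemma zero_near_spikes_zero q : 0 \in zero_near_spikes q.
Proof. by apply/asboolP => d; exists 0%N. Qed.

Lemma zero_near_spikes_indic0 q : indic k (pred1 0%N) \in zero_near_spikes q.
Proof.
apply/asboolP => d; exists d => i di j lo hi; rewrite /indic /=.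
case: eqP => // j0; move: lo; rewrite j0 add0n leqNgt.
have -> // : (d < 2 ^ spike_exp q i)%N.
apply: leq_trans (spike_exp_ge q di) _; rewrite leq_exp2l //; exact: leq_pred.
Qed.

Lemma zero_near_spikes_neq q q' : q' != q ->
  indic k (spike q') \in zero_near_spikes q.
Proof.
move=> /eqP qq'; apply/asboolP => d; exists d => i di j lo hi.
rewrite /indic; have [sj|//] := boolP (spike q' j).
by have [] := spike_near di lo hi sj.
Qed.

(** At distance deg P to the right of a remote spike, only that spike contributes, and the
    coefficient is the leading one of P. *)
Lemma zero_near_spikes_spike q (P : {poly k}) :
  P *: indic k (spike q) \in zero_near_spikes q -> P = 0.
Proof.
move=> /asboolP near0; apply/eqP/negP => /negP P0.
pose d := (size P).-1; have [i0 ni0] := near0 d.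
pose i := maxn i0 d; pose s := (2 ^ spike_exp q i)%N.
have := ni0 i (leq_maxl _ _) (s + d)%N.
have PE : (P *: indic k (spike q)) (s + d)%N = P`_d.
  rewrite -[LHS]/(\sum_(l < (s + d).+1) P`_l * indic k (spike q) (s + d - l)%N).
  have dl : (d < (s + d).+1)%N by rewrite ltnS leq_addl.
  rewrite (bigD1 (Ordinal dl)) //= addnK /indic spike_at mulr1 big1 ?addr0 //.
  move=> l ld; case: (ltnP l (size P)) => lP; last by rewrite nth_default ?mul0r.
  have [sl|_] := boolP (spike q (s + d - l)%N); last by rewrite mulr0.
  have ld' : (l <= d)%N by rewrite -ltnS (leq_trans lP) ?leqSpred.
  have [||_ /eqP] := @spike_near q q i (s + d - l)%N d (leq_maxr _ _) _ _ sl.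
  - by rewrite -/s; lia.
  - by rewrite -/s; lia.
  rewrite -/s => sE; case/eqP: ld; apply/val_inj => /=; lia.
rewrite PE => /(_ _ _)/eqP; rewrite -[P`_d]/(lead_coef P) lead_coef_eq0.
by move=> P0'; case/negP: P0; apply: P0'; rewrite -/s; lia.
Qed.

Lemma spike_functional q : exists phi : pser k -> K,
  [/\ {morph phi : m n / m + n}, forall a m, phi (a *: m) = iota a * phi m,
      phi (indic k (pred1 0%N)) = 0
    & forall q', phi (indic k (spike q')) = (q' == q)%:R].
Proof.
have [phi [phiD phiZ phi0 phi1]] := exists_functional iota_inj
  (zero_near_spikes_zero q) (@zero_near_spikesD q) (@zero_near_spikesZ q)
  (@zero_near_spikes_spike q).
exists phi; split=> // [|q']; first by rewrite phi0 // zero_near_spikes_indic0.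
have [->//|qq'] := eqVneq q' q.
by rewrite phi0 // zero_near_spikes_neq.
Qed.

End SpikeFunctionals.

Section TwistedFractions.
Variable k : fieldType.

Definition unip_frac : {fraction {poly k}} := tofrac (1 + 'X).

Lemma unip_frac_neq0 : unip_frac != 0.
Proof.
rewrite tofrac_eq0; apply/eqP => /(congr1 (coefp 0)) /eqP.
by rewrite /= coefD coef1 coefX coef0 addr0 oner_eq0.
Qed.

(** The substitution of t^-1 for t = 1 + x, hence of t^-1 - 1 for x; semilinearity along it gives
    psi(tm) = t^-1 psi(m). *)
Definition dual_frac : {rmorphism {poly k} -> {fraction {poly k}}} :=
  horner_eval (unip_frac^-1 - 1) \o map_poly (@tofrac _ \o polyC).

Lemma dual_frac_unip : dual_frac (1 + 'X) = unip_frac^-1.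
Proof.
rewrite -[LHS]/((map_poly (@tofrac _ \o polyC) (1 + 'X)).[unip_frac^-1 - 1]).
by rewrite rmorphD /= rmorph1 map_polyX hornerD hornerX -polyC1 hornerC addrC subrK.
Qed.

(** Since t (t^-1 - 1) = -x, the factor t^n with n = deg Q clears the denominators of Q(t^-1 - 1)
    and yields a polynomial [S]. *)
Lemma dual_frac_inj : injective dual_frac.
Proof.
suff dual_eq0 Q : dual_frac Q = 0 -> Q = 0.
  move=> P Q PQ; apply/subr0_eq/dual_eq0.
  by rewrite rmorphB PQ subrr.
move=> Q0; pose n := (size Q).-1.
(* The value of [S] at -1 is the leading coefficient of [Q]. *)
pose S := \sum_(i < size Q) Q`_i *: ((- 'X) ^+ i * (1 + 'X) ^+ (n - i)).
have SE : tofrac S = unip_frac ^+ n * dual_frac Q.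
  rewrite -[dual_frac Q]/((map_poly (@tofrac _ \o polyC) Q).[unip_frac^-1 - 1]).
  rewrite horner_coef size_map_poly mulr_sumr rmorph_sum; apply: eq_bigr => i _.
  have iN : (i <= n)%N by rewrite -ltnS (leq_trans (ltn_ord i)) ?leqSpred.
  have XE : tofrac (- 'X) = unip_frac * (unip_frac^-1 - 1).
    rewrite mulrBr mulfV ?unip_frac_neq0 // mulr1 /unip_frac rmorphD rmorph1.
    by rewrite opprD addrA subrr sub0r rmorphN.
  rewrite coef_map -mul_polyC !rmorphM !rmorphXn /= XE exprMn -/unip_frac.
  by rewrite -{2}(subnK iN) exprD; ring.
have S0 : S = 0 by apply/eqP; rewrite -tofrac_eq0 SE Q0 mulr0.
apply/eqP; rewrite -lead_coef_eq0; apply/eqP.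
have := congr1 (fun P => P.[-1]) S0; rewrite /= horner0 => S1.
rewrite -[RHS]S1 /S horner_sum.
case sQ : (size Q) => [|m]; first by rewrite big_ord0 /lead_coef sQ nth_default ?sQ.
have nm : n = m by rewrite /n sQ.
rewrite big_ord_recr big1 ?add0r => [|i _].
  by rewrite /lead_coef sQ nm subnn expr0 mulr1 !hornerE /= opprK expr1n mulr1.
by rewrite !hornerE /= subrr expr0n nm subn_eq0 leqNgt ltn_ord /= !mulr0.
Qed.

End TwistedFractions.

(** If all generators equal g, the endomorphism y -> g^(exponent of y) fixes them, so it is the
    identity; the exponent is the Z-component of a map to [lamp 'F_2]. *)
Lemma free_noncyclic (X : Type) (F : groupType) (i : X -> F) :
  free_on i -> ~ is_cyclic F -> exists x y, i x != i y.
Proof.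
move=> Ffree; apply: contra_notP => nxy.
have [g gE] : exists g, forall x, i x = g.
  have [[x0]|noX] := pselect (inhabited X); last first.
    by exists 1%g => x; case: noX; exists.
  exists (i x0) => x; apply/eqP/negPn/negP => xx0; apply: nxy.
  by exists x, x0.
have [phi [phiE _]] := Ffree (lamp 'F_2) (fun=> (1, 0)).
have fM : {morph (fun y => zexp g (phi y).1) : x y / (x * y)%g}.
  by move=> x y; rewrite gmulfM lampM1E zexpD.
pose f := HB.pack_for {multiplicative F -> F} (fun y => zexp g (phi y).1)
  (isMultiplicative.Build F F _ fM).
have [h [_ hE]] := Ffree F i.
have idE := hE idfun (fun=> erefl).
have fE : f =1 h by apply: hE => x; rewrite /= phiE gE.
exists g => y; have -> : y = zexp g (phi y).1.
  by have := fE y; rewrite -idE.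
by case: (phi y).1 => n; [exists n; left | exists n.+1; right].
Qed.

(** * The obstruction *)

Lemma iterate_system (A V : zmodType) (f : {additive A -> V}) (a x : nat -> A) :
  (forall n, x n = a n + x n.+1 *+ n.+2) ->
  forall N, f (x 0%N) = \sum_(n < N) f (a n) *+ n.+1`! + f (x N) *+ N.+1`!.
Proof.
move=> xE; elim=> [|N ->]; first by rewrite big_ord0 add0r.
rewrite big_ord_recr /= -addrA; congr (_ + _).
by rewrite {1}xE (raddfD f) (raddfMn f) mulrnDl -mulrnA -factS.
Qed.

Lemma natr_frac_neq0 p n : prime p ->
  (n%:R != 0 :> {fraction {poly 'F_p}}) = ~~ (p %| n)%N.
Proof.
move=> pp; have -> : n%:R = tofrac (n%:R)%:P :> {fraction {poly 'F_p}}.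
  by rewrite -[RHS]/((@tofrac _ \o polyC) n%:R) rmorph_nat.
by rewrite tofrac_eq0 polyC_eq0 -(dvdn_pcharf (pchar_Fp pp)).
Qed.

Lemma prime_ndvd_fact p n : prime p -> (n < p)%N -> ~~ (p %| n`!)%N.
Proof.
move=> pp; elim: n => [_|n IHn np]; first by rewrite dvdn1 neq_ltn prime_gt1 ?orbT.
by rewrite factS Euclid_dvdM // negb_or IHn ?(ltnW np) // gtnNdvd.
Qed.

(** An invertible diagonal matrix of size N factors through K^(size s). *)
Lemma rank_obstruction (K : fieldType) (T : Type) (N : nat) (s : seq T)
    (B C : nat -> T -> K) (d : nat -> K) :
  (forall i, (i < N)%N -> d i != 0) ->
  (forall i j, (i < N)%N -> (j < N)%N ->
     \sum_(g <- s) B i g * C j g = d i *+ (i == j)) ->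
  (N <= size s)%N.
Proof.
move=> d0 BC; case: s BC => [|t s] BC.
  rewrite leqn0; case: N d0 BC => // N /(_ 0%N isT) d0 /(_ 0%N 0%N isT isT).
  by rewrite big_nil eqxx mulr1n => /esym /eqP; rewrite (negPf d0).
pose r := t :: s; pose D : 'rV[K]_N := \row_i d i.
pose MB : 'M[K]_(N, size r) := \matrix_(i, l) B i (nth t r l).
pose MC : 'M[K]_(size r, N) := \matrix_(l, j) C j (nth t r l).
have MBC : MB *m MC = diag_mx D.
  apply/matrixP => i j; rewrite !mxE -(BC i j) // (big_nth t) big_mkord.
  by apply: eq_bigr => l _; rewrite !mxE.
have <- : \rank (MB *m MC) = N; last exact: mulmx_max_rank.
rewrite mxrank_unit // MBC unitmxE det_diag unitfE; apply/prodf_neq0 => i _.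
by rewrite mxE d0.
Qed.

Theorem theoremA (F : groupType) (F_free : is_free F)
    (F_noncyclic : ~ is_cyclic F) :
  ~ cotorsion (group_homology (pronilpotent_completion F) 2).
Proof.
case: F_free => X [i Ffree]; have [x [y xy]] := free_noncyclic Ffree F_noncyclic.
pose ab : {pred F} := pred2 (i x) (i y).
have aab : i x \in ab by rewrite unfold_in /= eqxx.
have bab : i y \in ab by rewrite unfold_in /= eqxx orbT.
(* Commutators are expanded in the subgroup of two basis elements, as [F] may have more
   generators. *)
pose E := generated_group ab.
pose a : E := Sub (i x) (sub_generated aab).
pose b : E := Sub (i y) (sub_generated bab).
have gen_ab z : z \in generated (pred2 a b).
  have := generated_group_gen z; apply: generated_ind.
  - exact: gpred1.
  - exact: gpredM.
  - exact: gpredVr.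
  - move=> w /orP[] /eqP wE; apply: sub_generated; apply/orP.
      by left; apply/eqP/val_inj; rewrite SubK.
    by right; apply/eqP/val_inj; rewrite SubK.
(* Even spikes are for phi and odd ones for psi, so the term phi(e') psi(e) vanishes by parity. *)
have class n := cid (lamp_class (val : {multiplicative E -> F}) gen_ab
  (spike0 n.*2) (spike0 n.*2.+1)).
move=> /(cotorsion_system (fun n => sval (class n)))[z zE].
have [s [m sE]] := pairing_sum (z 0%N).
(* [s] comes from [z 0] before any field is fixed, so p may be taken with p - 1 > size s. *)
have [p sp pp] := prime_above (size s).+1.
pose k : fieldType := 'F_p; pose K : fieldType := {fraction {poly k}}.
have [Phi [PhiE _]] := Ffree (lamp k) (fun w =>
  if `[< w = x >] then (0, indic k (pred1 0%N)) : lamp k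
  else if `[< w = y >] then (1, 0) : lamp k else 1%g).
have Pa : Phi (val a) = (0, indic k (pred1 0%N)) by rewrite SubK PhiE asboolT.
have Pb : Phi (val b) = (1, 0).
  rewrite SubK PhiE asboolF ?asboolT // => yx.
  by move: xy; rewrite yx eqxx.
have tofrac_inj : injective (@tofrac {poly k}).
  by move=> P Q /eqP; rewrite tofrac_eq => /eqP.
have phiP j := cid (spike_functional tofrac_inj j.*2).
have psiP j := cid (spike_functional (@dual_frac_inj k) j.*2.+1).
pose phi j := sval (phiP j); pose psi j := sval (psiP j).
have phi_unip j w : phi j (unip w) = unip_frac k * phi j w.
  by rewrite unipE; have [_ phiZ _ _] := svalP (phiP j); apply: phiZ.
have psi_unip j w : psi j (unip w) = (unip_frac k)^-1 * psi j w.
  rewrite unipE -dual_frac_unip; have [_ psiZ _ _] := svalP (psiP j).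
  exact: psiZ.
have phiD j : {morph phi j : u v / u + v} by have [] := svalP (phiP j).
have psiD j : {morph psi j : u v / u + v} by have [] := svalP (psiP j).
have phi0 j : phi j (indic k (pred1 0%N)) = 0 by have [] := svalP (phiP j).
have psi0 j : psi j (indic k (pred1 0%N)) = 0 by have [] := svalP (psiP j).
have phi_spike j q : phi j (indic k (spike q)) = (q == j.*2)%:R.
  by have [_ _ _ phiS] := svalP (phiP j); apply: phiS.
have psi_spike j q : psi j (indic k (spike q)) = (q == j.*2.+1)%:R.
  by have [_ _ _ psiS] := svalP (psiP j); apply: psiS.
pose c j l (u v : pronilpotent_completion F) :=
  lamp_cocycle (phi j) (psi l) (hat Phi u) (hat Phi v).
have cc j l : cocycle2 (c j l).
  exact: (cocycle2_comp [the {multiplicative _ -> _} of hat Phi]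
    (lamp_cocycleP (phiD j) (psiD l) (unip_frac_neq0 k) (phi_unip j) (psi_unip l))).
have c_class j l n : pairing (c j l) (sval (class n)) = ((n == j) && (n == l))%:R.
  rewrite (svalP (class n) k Phi Pa Pb K _ _ _ (phiD j) (psiD l)
    (unip_frac_neq0 k) (phi_unip j) (psi_unip l) (phi0 j) (psi0 l)).
  rewrite !phi_spike !psi_spike eqSS !(inj_eq double_inj).
  have -> : (n.*2.+1 == j.*2) = false.
    by apply/eqP => /(congr1 odd); rewrite /= !odd_double.
  by rewrite mul0r subr0 -natrM mulnb.
have c_z j l : (j < p.-1)%N -> pairing (c j l) (z 0%N) = j.+1`!%:R *+ (j == l).
  move=> jp; pose f := HB.pack_for
    {additive group_homology (pronilpotent_completion F) 2 -> K}
    (pairing (c j l))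
    (GRing.isZmodMorphism.Build _ _ _ (pairing_is_additive (cc j l))).
  (* After p - 1 steps the remainder is a multiple of p!, which is 0 in characteristic p, and in the
     sum only n = j can survive. *)
  have := iterate_system f zE p.-1; rewrite /f /= => ->.
  have p0 : p%:R = 0 :> K.
    by apply/eqP; rewrite -[_ == _]negbK natr_frac_neq0 ?dvdnn.
  rewrite (bigD1 (Ordinal jp)) //= big1 => [|n nj].
    rewrite c_class eqxx addr0 /= prednK ?prime_gt0 //.
    have -> : pairing (c j l) (z p.-1) *+ p`! = 0.
      by rewrite -(prednK (prime_gt0 pp)) factS prednK ?prime_gt0 // mulrnA
        -[_ *+ p]mulr_natr p0 mulr0 mul0rn.
    by rewrite addr0 -mulrnA mulnC mulrnA.
  rewrite c_class [(_ == j)](_ : _ = false) ?mul0rn //.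
  exact/negbTE.
suff : (p.-1 <= size s)%N by rewrite leqNgt -ltnS prednK ?prime_gt0 // sp.
(* On each simplex the cocycle is a factor depending on j times one depending on l; the diagonal
   entries (j+1)! are nonzero as j + 1 < p. *)
apply: (@rank_obstruction K _ p.-1 s
  (fun j g => phi j (zact (hat Phi g.2).1 (hat Phi g.1).2) *~ m g)
  (fun l g => psi l (hat Phi g.2).2) (fun j => j.+1`!%:R)) => [j jp|j l jp lp].
  by rewrite natr_frac_neq0 // prime_ndvd_fact // -(prednK (prime_gt0 pp)).
rewrite -c_z // sE; apply: eq_bigr => g _.
by rewrite /c /lamp_cocycle mulrzAl.
Qed.
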